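(* Let $h(c)$ denote the topological entropy of $F_{-1,c}|_{\Gamma_c}$, where $F_{-1,c}(x,y)=(|x|-y-1,\;x-|y|+c)$ and $\Gamma_c$ is its compact invariant graph. Let $\alpha\in(-112/137,-13/16)$ and $\beta\in(603/874,563/816)$ be the entropy transition values, i.e. the numbers such that for $c\in[-112/137,-13/16]$ one has $h(c)>0$ if and only if $c>\alpha$, and for $c\in[603/874,563/816]$ one has $h(c)>0$ if and only if $c>\beta$. Then $$\alpha\in\left(-\frac{140850476140085945702816746162288}{172399253286857828660669132569609},\;-\frac{1049417824596806956103568}{1284474531463219438945271}\right),$$ and the length of this interval is less than $4\times 10^{-40}$; and $$\beta\in\left(\frac{798396920638883099973166531706985228123}{1157210312199077596904301690272087447914},\;\frac{945506314303393205598153}{1370433212950874384162254}\right),$$ and the length of this interval is less than $5\times 10^{-50}$.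
   Context: The family is $F_{a,b}(x,y)=(|x|-y+a,\;x-|y|+b)$; for $a<0$ the map $F_{a,b}$ is conjugate by a homothety to $F_{-1,c}$ with $c=-b/a$, so $a=-1$ is taken. $\overline{PQ}$ denotes the closed segment with endpoints $P,Q$. Topological entropy is the usual one for continuous self-maps of compact metric spaces. Known background (earlier work): on each of the two intervals $[-112/137,-13/16]$ and $[603/874,563/816]$, $h$ is non-decreasing in $c$, and the transition values $\alpha$, $\beta$ described in the claim exist. (Globally, $h(c)>0$ if and only if $c\in(\alpha,-1/36)\cup(\beta,1)\cup(1,8)$.) The compact invariant graph $\Gamma_c$, i.e. the graph that eventually captures all orbits of $F_{-1,c}$ apart from those landing on certain exceptional periodic points, is as follows (write $b=c$). (i) For $b\in[-112/137,-13/16]$: $\Gamma_b$ is the union of $$\overline{P_2T_2},\ \overline{P_2R_2},\ \overline{R_2P_3},\ \overline{R_3P_4},\ \overline{R_4P_5},\ \overline{R_5P_6},\ \overline{R_6T_2},$$ where $P_2=(-b-2,-1)$, $P_3=(b+2,-3)$, $P_4=(b+4,2b-1)$, $P_5=(-b+4,4b+3)$, $P_6=(-5b,4b+7)$, $R_2=(b,-1)$, $R_3=(-b,2b-1)$, $R_4=(-3b,2b-1)$, $R_5=(-5b,-1)$, $R_6=(-5b,-4b-1)$, $T_2=(-5b-1,-4b)$. (ii) For $b\in[603/874,563/816]$: $\Gamma_b$ is the union of $$\overline{P_4R_2},\ \overline{P_1R_3},\ \overline{P_2X_3},\ \overline{X_2R_4},\ \overline{P_3X_3},\ \overline{R_5X_4},\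 \overline{R_2X_4},\ \overline{R_6T_2},\ \overline{R_3X_5},\ \overline{R_4X_6},\ \overline{R_5Z_2},\ \overline{Z_2X_7},\ \overline{R_6Z_3},\ \overline{Z_3Y_2},$$ where $P_1=(-b-2,-1)$, $P_2=(b+2,-3)$, $P_3=(b+4,2b-1)$, $P_4=(-b+4,5)$, $R_2=(-2b,1-b)$, $R_3=(3b-2,-1)$, $R_4=(3b-2,4b-3)$, $R_5=(-b,8b-5)$, $R_6=(-7b+4,-8b+5)$, $T_2=(b-1,0)$, $X_2=(0,b-1)$, $X_3=(-b,2b-1)$, $X_4=(-b,1-2b)$, $X_5=(3b-2,1-2b)$, $X_6=(5b-4,2b-1)$, $X_7=(-7b+4,4b-3)$, $Y_2=(7b-5,-6b+4)$, $Z_2=(-7b+4,8b-5)$, $Z_3=(-b,9-14b)$. *)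

(* Defs.v *)
From HB Require Import structures.
From mathcomp Require Import all_boot all_order all_algebra finmap.
From mathcomp Require Import all_classical all_reals all_analysis.
Set Implicit Arguments.
Unset Strict Implicit.
Unset Printing Implicit Defensive.
Import Order.TTheory GRing.Theory Num.Theory.
Import numFieldNormedType.Exports.
Local Open Scope classical_set_scope.
Local Open Scope ring_scope.

Section TopologicalEntropy.
Context {R : realType} {T : pseudoMetricType R}.

(* As [ball] is open, [~ ball u e v] means d(u, v) >= e: distinct points of E
   are at distance at least e for the metric max_(k < n) d(f^k x, f^k y). *)
Definition separated (f : T -> T) (n : nat) (e : R) (E : set T) : Prop :=
  forall x y, E x -> E y -> x != y ->
    exists2 k, (k < n)%N & ~ ball (iter k f x) e (iter k f y).

Definition sep_number (f : T -> T) (K : set T) (n : nat) (e : R) : \bar R :=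
  ereal_sup [set (#|` E|%:R)%:E | E in
    [set E : {fset T} | [set` E] `<=` K /\ separated f n e [set` E]]].

(* Entropy of the restriction of f to K, for K compact and f-invariant
   (Bowen-Dinaburg definition by separated sets). *)
Definition topological_entropy (f : T -> T) (K : set T) : \bar R :=
  lim ((limn_esup (fun n => n%:R^-1%:E * lne (sep_number f K n e))%E)
         @[e --> 0^'+]).

End TopologicalEntropy.

Section Family.
Context {R : realType}.
Implicit Types (a b : R) (p q : R * R).

Definition F a b p : R * R := (`|p.1| - p.2 + a, p.1 - `|p.2| + b).

Definition segment p q : set (R * R) :=
  [set (1 - t) *: p + t *: q | t in `[0, 1]].

(* The invariant graph for -112/137 <= b <= -13/16. *)
Definition Gamma_neg b : set (R * R) :=
  let P2 := (- b - 2, -1) in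
  let P3 := (b + 2, -3) in
  let P4 := (b + 4, 2 * b - 1) in
  let P5 := (- b + 4, 4 * b + 3) in
  let P6 := (- 5 * b, 4 * b + 7) in
  let R2 := (b, -1) in
  let R3 := (- b, 2 * b - 1) in
  let R4 := (- 3 * b, 2 * b - 1) in
  let R5 := (- 5 * b, -1) in
  let R6 := (- 5 * b, - 4 * b - 1) in
  let T2 := (- 5 * b - 1, - 4 * b) in
  segment P2 T2 `|` segment P2 R2 `|` segment R2 P3 `|` segment R3 P4 `|`
  segment R4 P5 `|` segment R5 P6 `|` segment R6 T2.

(* The invariant graph for 603/874 <= b <= 563/816. *)
Definition Gamma_pos b : set (R * R) :=
  let P1 := (- b - 2, -1) in
  let P2 := (b + 2, -3) in
  let P3 := (b + 4, 2 * b - 1) in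
  let P4 := (- b + 4, 5) in
  let R2 := (- 2 * b, 1 - b) in
  let R3 := (3 * b - 2, -1) in
  let R4 := (3 * b - 2, 4 * b - 3) in
  let R5 := (- b, 8 * b - 5) in
  let R6 := (- 7 * b + 4, - 8 * b + 5) in
  let T2 := (b - 1, 0) in
  let X2 := (0, b - 1) in
  let X3 := (- b, 2 * b - 1) in
  let X4 := (- b, 1 - 2 * b) in
  let X5 := (3 * b - 2, 1 - 2 * b) in
  let X6 := (5 * b - 4, 2 * b - 1) in
  let X7 := (- 7 * b + 4, 4 * b - 3) in
  let Y2 := (7 * b - 5, - 6 * b + 4) in
  let Z2 := (- 7 * b + 4, 8 * b - 5) in
  let Z3 := (- b, 9 - 14 * b) in
  segment P4 R2 `|` segment P1 R3 `|` segment P2 X3 `|` segment X2 R4 `|`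
  segment P3 X3 `|` segment R5 X4 `|` segment R2 X4 `|` segment R6 T2 `|`
  segment R3 X5 `|` segment R4 X6 `|` segment R5 Z2 `|` segment Z2 X7 `|`
  segment R6 Z3 `|` segment Z3 Y2.

End Family.

(* Main.v *)
(* Call c < c' the two ends of one of the intervals. At a rational parameter slightly above
   c, the orbits of the vertices of the invariant graph are finite and cut it into finitely
   many arcs, on each of which F is affine and either constant or not contracting for the
   sup distance. The image of an arc is a union of arcs, and the arcs carry levels that
   never increase from an arc to those of its image and are shared by at most one of them:
   hence the number of itineraries, and with it the number of separated points, grows
   polynomially and the entropy vanishes. At c' there is a segment J of the graph with two
   disjoint subsegments that an iterate of F maps affinely onto J, so the entropy is
   positive. At both parameters the orbits are integral after multiplication by the
   denominator of the parameter, so the combinatorial conditions are decided by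
   computation with integers. *)
From Stdlib Require Import ZArith.
Require Import Defs.
From mathcomp Require Import all_boot all_order all_algebra finmap.
From mathcomp Require Import all_classical all_reals all_analysis.
From mathcomp Require Import ring lra zify ssrZ.
Set Implicit Arguments.
Unset Strict Implicit.
Unset Printing Implicit Defensive.
Import Order.TTheory GRing.Theory Num.Theory.
Import numFieldNormedType.Exports.
Local Open Scope classical_set_scope.
Local Open Scope ring_scope.

(** * Upper limits of extended real sequences *)

Section LimnEsup.
Variable R : realType.
Implicit Types u v : (\bar R)^nat.

(** An upper limit is the infimum, over the neighbourhoods of infinity, of the suprema on them, and
    the set where the bound holds is such a neighbourhood. *)
Lemma limn_esup_le u (a : \bar R) :
  (\forall n \near \oo, (u n <= a)%E) -> (limn_esup u <= a)%E.
Proof.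
move=> ua; apply: (@le_trans _ _ (ereal_sup (u @` [set n | (u n <= a)%E]))).
  by apply: ereal_inf_lbound; exists [set n | (u n <= a)%E].
by apply: ge_ereal_sup => _ [n ? <-].
Qed.

Lemma limn_esup_ge u (a : \bar R) :
  (\forall n \near \oo, (a <= u n)%E) -> (a <= limn_esup u)%E.
Proof.
move=> au; apply: le_ereal_inf_tmp => _ [V VF <-].
have [n [Vn aun]] : (V `&` [set n | (a <= u n)%E]) !=set0.
  by apply: (@filter_ex _ \oo); apply: filterI.
by apply: le_trans aun _; apply: ereal_sup_ubound; exists n.
Qed.

Lemma limn_esup_mono u v :
  (forall n, (u n <= v n)%E) -> (limn_esup u <= limn_esup v)%E.
Proof.
move=> uv; apply: le_ereal_inf_tmp => _ [V VF <-].
apply: (@le_trans _ _ (ereal_sup (u @` V))).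
  by apply: ereal_inf_lbound; exists V.
apply: ge_ereal_sup => _ [n Vn <-]; apply: le_trans (uv n) _.
by apply: ereal_sup_ubound; exists n.
Qed.

End LimnEsup.

(** * Separation numbers, and entropy as a supremum over scales *)

Section Entropy.
Context {R : realType} {T : pseudoMetricType R}.
Variables (f : T -> T) (K : set T).

Lemma sep_number_ge0 n e : (0 <= sep_number f K n e)%E.
Proof.
apply: ereal_sup_ubound; exists fset0; last by rewrite cardfs0.
by split => [x|x y] /=; rewrite inE.
Qed.

Lemma sep_number_ge_size n e (s : seq T) :
  uniq s -> (forall x, x \in s -> K x) -> Defs.separated f n e [set` s] ->
  ((size s)%:R%:E <= sep_number f K n e)%E.
Proof.
move=> us sK ss; apply: ereal_sup_ubound.
exists [fset x in s]%fset; last by rewrite card_fseq undup_id.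
split=> [x|x y] /=; first by rewrite inE; exact: sK.
by rewrite !inE => xs ys; exact: ss.
Qed.

Lemma sep_number_le n e (b : nat) :
  (forall s : seq T, uniq s -> (forall x, x \in s -> K x) ->
    Defs.separated f n e [set` s] -> (size s <= b)%N) ->
  (sep_number f K n e <= b%:R%:E)%E.
Proof.
move=> sb; apply: ge_ereal_sup => _ [E [EK Es] <-].
by rewrite lee_fin ler_nat; apply: sb => [|x|] //; [exact: fset_uniq|exact: EK].
Qed.

Lemma le_sep_number n e e' :
  e <= e' -> (sep_number f K n e' <= sep_number f K n e)%E.
Proof.
move=> ee'; apply: ge_ereal_sup => _ [E [EK Es] <-].
apply: ereal_sup_ubound; exists E => //; split=> // x y Ex Ey xy.
have [k kn nb] := Es x y Ex Ey xy; exists k => // bxy; apply: nb.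
exact: le_ball bxy.
Qed.

(** Separation numbers decrease as the scale [e] grows, so the right limit at 0 is a supremum. An
    upper bound then has to be proved at every scale below 1, a lower bound at a single one. *)
Lemma topological_entropyE :
  topological_entropy f K = ereal_sup
    [set limn_esup (fun n => n%:R^-1%:E * lne (sep_number f K n e))%E
      | e in `]0, 1[].
Proof.
apply: cvg_lim => //; apply: nonincreasing_at_right_cvge; first by rewrite bnd_simp.
move=> e e' _ _ ee'; apply: limn_esup_mono => n.
rewrite lee_wpmul2l ?lee_fin ?invr_ge0 //.
by rewrite lee_lne ?in_itv /= ?leey ?sep_number_ge0 ?andbT // le_sep_number.
Qed.

End Entropy.

(** * Subexponential growth of polynomials *)

Section Growth.
Context {R : realType}.

(** From [ln x = 2 ln (sqrt x) <= 2 sqrt x] the logarithm is at most [A + B * sqrt n], and each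
    summand is eventually below [n * d / 2]. *)
Lemma ln_poly_sublinear (a b L : nat) (d : R) : 0 < d ->
  \forall n \near \oo, n%:R^-1 * ln ((a.+1 * (b.+1 * n) ^ L)%:R) <= d.
Proof.
move=> d0; pose A : R := ln a.+1%:R; pose B : R := L%:R * 2 * Num.sqrt b.+1%:R.
near=> n.
have n0 : (0 : R) < n%:R by near: n; exact: nbhs_infty_gtr.
have bn0 : (0 : R) < b.+1%:R * n%:R by rewrite mulr_gt0.
have sn0 : (0 : R) < Num.sqrt n%:R by rewrite sqrtr_gt0.
have lnbn : ln (b.+1%:R * n%:R : R) <= 2 * (Num.sqrt b.+1%:R * Num.sqrt n%:R).
  rewrite -[X in ln X](@sqr_sqrtr R); last exact: ltW.
  rewrite lnXn ?sqrtr_gt0// -[leLHS]mulr_natl -sqrtrM ?ler0n//.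
  by rewrite ler_pM2l// ltW// ln_sublinear// sqrtr_gt0.
rewrite natrM natrX natrM lnM ?posrE ?exprn_gt0// ?ltr0Sn//.
rewrite lnXn ?mulr_gt0// -[X in _ + X]mulr_natl ler_pdivrMl//.
apply: (@le_trans _ _ (A + B * Num.sqrt n%:R)).
  rewrite lerD2l /B -!mulrA ler_wpM2l//.
have -> : n%:R * d = n%:R * (d / 2) + n%:R * (d / 2) :> R by field.
apply: lerD.
  rewrite -ler_pdivrMr ?divr_gt0//; near: n; exact: nbhs_infty_ger.
have -> : n%:R * (d / 2) = Num.sqrt n%:R * (Num.sqrt n%:R * (d / 2)) :> R.
  by rewrite [RHS]mulrA -expr2 sqr_sqrtr.
rewrite [B * _]mulrC ler_pM2l//.
rewrite -ler_pdivrMr ?divr_gt0//.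
(* [B] vanishes when [L = 0]; otherwise squaring turns the goal into a lower bound on [n]. *)
have [B0|B0] := leP (B / (d / 2)) 0; first exact: le_trans B0 (ltW sn0).
rewrite -[leLHS](ger0_norm (ltW B0)) -sqrtr_sqr ler_sqrt ?ler0n//.
near: n; exact: nbhs_infty_ger.
Unshelve. all: by end_near.
Qed.

End Growth.

(** * Arcs graded by levels, polynomial growth and zero entropy *)

Lemma leq_size_cover (U : eqType) (I : Type) (js : seq I) (P : I -> pred U) (s : seq U) :
  (forall x, x \in s -> has (P^~ x) js) -> (size s <= \sum_(j <- js) count (P j) s)%N.
Proof.
elim: s => [|x s IH] //= sP; under eq_bigr do rewrite /=.
rewrite big_split /= -add1n leq_add ?IH // => [|y ys]; last first.
  by apply: sP; rewrite inE ys orbT.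
have := sP x (mem_head x s).
elim: js {IH sP} => //= j js IH; rewrite big_cons.
case: (P j x) => //= h; exact: IH.
Qed.

Section PolynomialGrowth.
Context {R : realType} {T : pseudoMetricType R}.
Variables (f : T -> T) (m M C : nat).
Variables (A : nat -> set T) (succ : nat -> seq nat) (lev : nat -> nat) (e : R).
Hypothesis e_gt0 : 0 < e.
Hypothesis succ_lt : forall i j, (i < m)%N -> j \in succ i -> (j < m)%N.
Hypothesis succ_cover : forall i x, (i < m)%N -> A i x -> succ i != [::] ->
  exists2 j, j \in succ i & A j (f x).
Hypothesis collapse : forall i x y, (i < m)%N -> A i x -> A i y -> succ i = [::] ->
  f x = f y.
Hypothesis expand : forall i x y r, (i < m)%N -> A i x -> A i y -> succ i != [::] ->
  ball (f x) r (f y) -> ball x r y.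
Hypothesis lev_noninc : forall i j, (i < m)%N -> j \in succ i -> (lev j <= lev i)%N.
Hypothesis lev_uniq : forall i, (i < m)%N -> (count (fun j => lev j == lev i) (succ i) <= 1)%N.
Hypothesis succ_size : forall i, (i < m)%N -> (size (succ i) <= M)%N.
Hypothesis sep1 : forall i s, (i < m)%N -> uniq s -> (forall x, x \in s -> A i x) ->
  Defs.separated f 1 e [set` s] -> (size s <= C)%N.

(** Induction on [n]. The points of [s] are sorted by the successor of [i] that contains their
    image, and by [expand] the images are separated over one step fewer. At most one successor has
    the level of [i] and the others have lower ones, so passing from [n] to [n + 1] adds at most a
    polynomial of degree [lev i - 1], and the total has degree [lev i]. *)
Lemma separated_size_le n i (s : seq T) :
  (i < m)%N -> uniq s -> (forall x, x \in s -> A i x) ->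
  Defs.separated f n.+1 e [set` s] -> (size s <= C * (M.+1 * n.+1) ^ lev i)%N.
Proof.
elim: n i s => [|n IH] i s im us sA ss.
  by apply: leq_trans (sep1 im us sA ss) _; rewrite leq_pmulr// expn_gt0.
(* Without successors the arc collapses after one step, so points can only be separated at time 0
   and [sep1] applies. *)
have [si0|si0] := eqVneq (succ i) [::].
  apply: (@leq_trans C); last by rewrite leq_pmulr// expn_gt0.
  apply: (sep1 im us sA) => x y xs ys xy.
  have [[|k] kn nb] := ss x y xs ys xy; first by exists 0%N.
  exfalso; apply: nb; rewrite !iterSr (collapse im (sA _ xs) (sA _ ys) si0).
  exact: ballxx.
pose B l := (C * (M.+1 * n.+1) ^ l)%N.
pose P j : pred T := fun x => `[< A j (f x) >].
apply: (@leq_trans (\sum_(j <- succ i) count (P j) s)%N).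
  apply: leq_size_cover => x xs; apply/hasP.
  by have [j js Aj] := succ_cover im (sA _ xs) si0; exists j => //; apply/asboolP.
apply: (@leq_trans (\sum_(j <- succ i) B (lev j))%N).
  rewrite big_seq [leqRHS]big_seq; apply: leq_sum => j js.
  rewrite -size_filter -(size_map f); apply: IH; first exact: succ_lt js.
  (* Points with the same image can only be separated at time 0, and there [expand] puts them within
     [e] of each other. *)
  - rewrite map_inj_in_uniq ?filter_uniq// => x y.
    rewrite !mem_filter => /andP[_ xs] /andP[_ ys] fxy.
    apply/eqP; apply: contraT => xy; have [k _] := ss x y xs ys xy; case.
    case: k => [|k]; last by rewrite !iterSr fxy; exact: ballxx.
    by apply: (expand im (sA _ xs) (sA _ ys) si0); rewrite fxy; exact: ballxx.
  - by move=> _ /mapP[x + ->]; rewrite mem_filter => /andP[/asboolP].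
  - move=> _ _ /mapP[x + ->] /mapP[y + ->].
    rewrite !mem_filter => /andP[_ xs] /andP[_ ys] fxy.
    have xy : x != y by apply: contra_neq fxy => ->.
    have [[|k] kn nb] := ss x y xs ys xy; last first.
      by exists k => //; rewrite -!iterSr.
    by exists 0%N => //= b; apply: nb; apply: (expand im (sA _ xs) (sA _ ys) si0).
(* The factor [0 < lev i] removes the second term at level 0, where no successor has a lower level
   and the predecessor would again be 0. *)
have sumB : (\sum_(j <- succ i) B (lev j) <=
    count (fun j => lev j == lev i) (succ i) * B (lev i) +
    size (succ i) * ((0 < lev i) * B (lev i).-1))%N.
  rewrite -sum1_count -sum1_size !big_distrl /= [in leqRHS]big_mkcond /= -big_split /=.
  rewrite big_seq [leqRHS]big_seq; apply: leq_sum => j js.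
  case: eqVneq => [->|ne]; first by rewrite mul1n leq_addr.
  have lt : (lev j < lev i)%N by rewrite ltn_neqAle ne (lev_noninc im js).
  rewrite (leq_ltn_trans _ lt)// !mul1n add0n leq_mul2l leq_pexp2l ?orbT//.
  by rewrite -ltnS prednK// (leq_ltn_trans _ lt).
apply: leq_trans sumB _.
apply: (@leq_trans (1 * B (lev i) + M * ((0 < lev i) * B (lev i).-1))%N).
  by rewrite leq_add// leq_mul2r ?lev_uniq ?succ_size ?orbT.
case: (lev i) => [|l]; first by rewrite /B !expn0 mul0n muln0; lia.
(* With [X = (M + 1)(n + 1)] the sum is [C * (X + M) * X ^ l], and [X + M < (M + 1)(n + 2)]. *)
rewrite /B /= mul1n mul1n mulnCA -mulnDr leq_mul2l expnS -mulnDl expnS.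
apply/orP; right; apply: leq_mul; first by lia.
by case: l => // l; rewrite leq_exp2r// leq_mul2l leqnSn orbT.
Qed.

End PolynomialGrowth.

(** Finitely many arcs give uniform constants for [separated_size_le]. Adding the counts over the
    arcs that cover [K] leaves a polynomial bound at each scale, so the exponential growth rate is
    below every [d > 0]. *)
Lemma topological_entropy_le0 {R : realType} {T : pseudoMetricType R}
    (f : T -> T) (K : set T) (m : nat)
    (A : nat -> set T) (succ : nat -> seq nat) (lev : nat -> nat) :
  (forall i j, (i < m)%N -> j \in succ i -> (j < m)%N) ->
  (forall i x, (i < m)%N -> A i x -> succ i != [::] ->
    exists2 j, j \in succ i & A j (f x)) ->
  (forall i x y, (i < m)%N -> A i x -> A i y -> succ i = [::] -> f x = f y) ->
  (forall i x y r, (i < m)%N -> A i x -> A i y -> succ i != [::] ->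
    ball (f x) r (f y) -> ball x r y) ->
  (forall i j, (i < m)%N -> j \in succ i -> (lev j <= lev i)%N) ->
  (forall i, (i < m)%N -> (count (fun j => lev j == lev i) (succ i) <= 1)%N) ->
  (forall i e, (i < m)%N -> 0 < e -> exists C, forall s,
    uniq s -> (forall x, x \in s -> A i x) ->
    Defs.separated f 1 e [set` s] -> (size s <= C)%N) ->
  (forall x, K x -> exists2 i, (i < m)%N & A i x) ->
  (topological_entropy f K <= 0)%E.
Proof.
move=> slt scov coll expd levn levu sep1 KA.
rewrite topological_entropyE; apply: ge_ereal_sup => _ [e /= + <-].
rewrite in_itv /= => /andP[e0 _].
have /choice[Cf CfP] : forall i : nat, exists C, (i < m)%N -> forall s : seq T,
    uniq s -> (forall x, x \in s -> A i x) ->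
    Defs.separated f 1 e [set` s] -> (size s <= C)%N.
  move=> i; have [im|//] := ltnP i m; last by exists 0%N.
  by have [C CP] := sep1 i e im e0; exists C.
pose C := \max_(i < m) Cf i; pose M := \max_(i < m) size (succ i).
pose L := \max_(i < m) lev i.
(* The successor in [(m * C).+1] keeps the bound positive, so that its logarithm can be taken even
   if [m * C] is 0. *)
have sizeE n s : uniq s -> (forall x, x \in s -> K x) ->
    Defs.separated f n.+1 e [set` s] ->
    (size s <= (m * C).+1 * (M.+1 * n.+1) ^ L)%N.
  move=> us sK ss; pose P i : pred T := fun x => `[< A i x >].
  apply: (@leq_trans (\sum_(i <- iota 0 m) count (P i) s)%N).
    apply: leq_size_cover => x xs; apply/hasP.
    by have [i im Ai] := KA _ (sK _ xs); exists i; [rewrite mem_iota|apply/asboolP].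
  apply: (@leq_trans (\sum_(i <- iota 0 m) C * (M.+1 * n.+1) ^ L)%N); last first.
    by rewrite big_const_seq count_predT size_iota iter_addn_0; lia.
  rewrite big_seq [leqRHS]big_seq; apply: leq_sum => i; rewrite mem_iota /= => im.
  rewrite -size_filter.
  apply: (@leq_trans (C * (M.+1 * n.+1) ^ lev i)%N); last first.
    by rewrite leq_mul2l leq_pexp2l ?orbT// (@leq_bigmax _ (lev \o val) (Ordinal im)).
  apply: (@separated_size_le R T f m M C A succ lev e) => //.
  - by move=> k km; exact: (@leq_bigmax _ (fun i : 'I_m => size (succ i)) (Ordinal km)).
  - move=> k t km ut tA st; apply: leq_trans (CfP k km t ut tA st) _.
    exact: (@leq_bigmax _ (fun i : 'I_m => Cf i) (Ordinal km)).
  - exact: filter_uniq.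
  - by move=> x; rewrite mem_filter => /andP[/asboolP].
  - move=> x y /=; rewrite !mem_filter => /andP[_ xs] /andP[_ ys]; exact: ss.
apply/lee_addgt0Pr => d d0; rewrite add0e.
apply: limn_esup_le; near=> n.
have n0 : (0 < n)%N by near: n; exists 1%N.
apply: (@le_trans _ _ (n%:R^-1 * ln ((m * C).+1 * (M.+1 * n) ^ L)%:R)%:E).
  rewrite EFinM lee_wpmul2l ?lee_fin ?invr_ge0//.
  rewrite -lne_EFin; last by rewrite ltr0n muln_gt0 expn_gt0 muln_gt0 n0.
  rewrite lee_lne ?in_itv /= ?leey ?sep_number_ge0 ?lee_fin ?ler0n//.
  by apply: sep_number_le => s; rewrite -(prednK n0); exact: sizeE.
rewrite lee_fin; near: n; exact: ln_poly_sublinear.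
Unshelve. all: by end_near.
Qed.

(** * Horseshoes and positive entropy *)

(** Since the [N]-th iterate maps both [J0] and [J1] over [J], it has two right inverses [g0] and
    [g1] on [J]. Composing [k] of them in all ways from one point of [J] yields [2 ^ k] points
    separated within [N * k] steps. *)
Lemma horseshoe_entropy_gt0 {R : realType} {T : pseudoMetricType R}
    (f : T -> T) (K J J0 J1 : set T) (N : nat) (e0 : R) :
  (0 < N)%N -> 0 < e0 -> J !=set0 -> J `<=` K -> J0 `<=` J -> J1 `<=` J ->
  J `<=` iter N f @` J0 -> J `<=` iter N f @` J1 ->
  (forall x y, J0 x -> J1 y -> ~ ball x e0 y) ->
  (0 < topological_entropy f K)%E.
Proof.
move=> N0 e00 [x0 Jx0] JK J0J J1J Jf0 Jf1 J01.
have inv (J' : set T) : J `<=` iter N f @` J' -> exists g : T -> T,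
    forall y, J y -> J' (g y) /\ iter N f (g y) = y.
  move=> Jf; have /choice[g gP] y : exists x, J y -> J' x /\ iter N f x = y.
    (* [x0] is the default value of the branch outside [J]. *)
    have [Jy|nJ] := pselect (J y); last by exists x0.
    by have [x Jx <-] := Jf y Jy; exists x.
  by exists g.
have [g0 g0P] := inv _ Jf0; have [g1 g1P] := inv _ Jf1.
(* Induction on [k], applying both branches to the points found so far. Images under the same branch
   separate [N] steps later than the points themselves; images under different branches lie in [J0]
   and [J1] and are apart at time 0. *)
have words k : exists s : seq T, [/\ uniq s, size s = (2 ^ k)%N,
    forall x, x \in s -> J x & Defs.separated f (N * k) e0 [set` s]].
  elim: k => [|k [s [us ss sJ ssep]]].
    exists [:: x0]; split => // [x|x y] /=; rewrite ?inE; first by move/eqP->.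
    by move=> /eqP-> /eqP->; rewrite eqxx.
  have branch g : (forall y, J y -> iter N f (g y) = y) -> forall a b,
      a \in s -> b \in s -> g a != g b ->
      exists2 i, (i < N * k.+1)%N & ~ ball (iter i f (g a)) e0 (iter i f (g b)).
    move=> gK a b sa sb gab; have ab : a != b by apply: contra_neq gab => ->.
    have [i ik nb] := ssep a b sa sb ab.
    by exists (i + N)%N; [rewrite mulnS addnC ltn_add2l|rewrite !iterD !gK//; exact: sJ].
  have g_inj g : (forall y, J y -> iter N f (g y) = y) -> {in s &, injective g}.
    by move=> gK a b sa sb gab; rewrite -(gK a) ?gab ?gK//; exact: sJ.
  have g0K y : J y -> iter N f (g0 y) = y by move=> /g0P[].
  have g1K y : J y -> iter N f (g1 y) = y by move=> /g1P[].
  exists ([seq g0 x | x <- s] ++ [seq g1 x | x <- s]); split.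
  - rewrite cat_uniq !map_inj_in_uniq ?us; [|exact: g_inj..].
    rewrite andbT /=; apply/hasPn => _ /mapP[b bs ->]; apply/negP => /mapP[a sa ab].
    apply: (J01 (g0 a) (g1 b)); [exact: (g0P _ (sJ _ sa)).1|exact: (g1P _ (sJ _ bs)).1|].
    by rewrite ab; exact: ballxx.
  - by rewrite size_cat !size_map ss expnS mul2n addnn.
  - move=> x; rewrite mem_cat => /orP[] /mapP[a sa ->].
    + exact/J0J/(g0P _ (sJ _ sa)).1.
    + exact/J1J/(g1P _ (sJ _ sa)).1.
  - move=> x y /=; rewrite !mem_cat.
    have Nk : (0 < N * k.+1)%N by rewrite muln_gt0 N0.
    move=> /orP[] /mapP[a sa ->] /orP[] /mapP[b sb ->]; [exact: branch| | |exact: branch].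
    + move=> _; exists 0%N => //=.
      by apply: J01; [exact: (g0P _ (sJ _ sa)).1|exact: (g1P _ (sJ _ sb)).1].
    + move=> _; exists 0%N => //= bb.
      apply: (J01 (g0 b) (g1 a)); last exact: ball_sym.
      * exact: (g0P _ (sJ _ sb)).1.
      * exact: (g1P _ (sJ _ sa)).1.
have sep_ge n e : e <= e0 -> ((2 ^ (n %/ N))%:R%:E <= sep_number f K n e)%E.
  move=> ee0; have [s [us ss sJ ssep]] := words (n %/ N)%N.
  rewrite -ss; apply: sep_number_ge_size => // [x xs|x y xs ys xy]; first exact/JK/sJ.
  have [i iN nb] := ssep x y xs ys xy; exists i.
    by apply: leq_trans iN _; rewrite mulnC leq_trunc_div.
  by move=> b; apply: nb; exact: le_ball b.
rewrite topological_entropyE.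
(* [e1] brings the scale into []0, 1[]. Only whole blocks of [N] steps count, and [n %/ N] is at
   least [n / (2 * N)] once [N <= n]: hence the factor 2 in [c]. *)
pose e1 := Num.min e0 (1 / 2); pose c : R := ln 2 / (2 * N)%:R.
apply: (@lt_le_trans _ _ c%:E).
  by rewrite lte_fin divr_gt0 ?ln_gt0 ?ltr1n// ltr0n muln_gt0.
apply: (@le_trans _ _ (limn_esup (fun n => n%:R^-1%:E * lne (sep_number f K n e1))%E)); last first.
  apply: ereal_sup_ubound; exists e1 => //=.
  rewrite in_itv /= lt_min e00 /= gt_min; apply/andP; split; first by lra.
  by apply/orP; right; lra.
apply: limn_esup_ge; near=> n.
have Nn : (N <= n)%N by near: n; exists N.
have n0 : (0 < n)%N by apply: leq_trans Nn.
apply: (@le_trans _ _ (n%:R^-1 * ln ((2 ^ (n %/ N))%:R : R))%:E).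
  rewrite lee_fin natrX lnXn// -[X in _ * X]mulr_natl ler_pdivlMl ?ltr0n// /c.
  rewrite mulrCA mulrC ler_pM2r ?ln_gt0 ?ltr1n//.
  rewrite ler_pdivrMr ?ltr0n ?muln_gt0// -natrM ler_nat.
  have := ltn_ceil n N0; have : (0 < n %/ N)%N by rewrite divn_gt0.
  nia.
rewrite EFinM lee_wpmul2l ?lee_fin ?invr_ge0//.
rewrite -lne_EFin ?ltr0n ?expn_gt0//.
rewrite lee_lne ?in_itv /= ?leey ?sep_number_ge0 ?lee_fin ?ler0n//.
by apply: sep_ge; rewrite ge_min lexx.
Unshelve. all: by end_near.
Qed.

(** * Decidable conditions on integral segments *)

Section ScaledPlane.
Local Open Scope Z_scope.

(* A point [(X, Y)] stands for the point [(X / D, Y / D)] of the plane, and [C] for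
   the parameter [c = C / D]; in these coordinates all orbits are integral. *)
Definition Zpoint := (Z * Z)%type.

Definition ZF (C D : Z) (p : Zpoint) : Zpoint :=
  (Z.abs p.1 - p.2 - D, p.1 - Z.abs p.2 + C).

Definition Zpoint_eqb (p q : Zpoint) : bool := (p.1 =? q.1) && (p.2 =? q.2).

Definition between (a b x : Z) : bool :=
  (a <=? x) && (x <=? b) || (b <=? x) && (x <=? a).

(** All segments of both graphs are horizontal, vertical or diagonal, and on a quadrant [F] maps
    these directions to one another or collapses them. Membership is therefore decided for these
    directions only. *)
Definition on_segment (p q r : Zpoint) : bool :=
  [&& between p.1 q.1 r.1, between p.2 q.2 r.2 &
  [|| p.1 =? q.1, p.2 =? q.2,
      (p.1 - p.2 =? q.1 - q.2) && (p.1 - p.2 =? r.1 - r.2)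
    | (p.1 + p.2 =? q.1 + q.2) && (p.1 + p.2 =? r.1 + r.2)]].

Definition same_sign (a b : Z) : bool :=
  (0 <=? a) && (0 <=? b) || (a <=? 0) && (b <=? 0).

Definition same_quadrant (p q : Zpoint) : bool :=
  same_sign p.1 q.1 && same_sign p.2 q.2.

Definition Zdist (p q : Zpoint) : Z :=
  Z.max (Z.abs (p.1 - q.1)) (Z.abs (p.2 - q.2)).

(** Each segment is stored in one orientation but may be traversed in the other. The far end [r] has
    to lie on what remains of the segment, so the path never leaves it. *)
Fixpoint chain (p q : Zpoint) (ss : seq (Zpoint * Zpoint)) : bool :=
  if ss is (a, b) :: ss' then
    let r := if Zpoint_eqb a p then b else a in
    [&& Zpoint_eqb a p || Zpoint_eqb b p, on_segment p q r & chain r q ss']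
  else Zpoint_eqb p q.

(* An arc [(p, q, l, js)] has endpoints [p] and [q], level [l], and an image covered by
   the arcs of indices [js]; [js] is empty when the arc is mapped to a point. *)
Definition arc := (Zpoint * Zpoint * nat * seq nat)%type.

Definition arc0 : arc := ((0, 0), (0, 0), 0%N, [::]).

(** For an empty [js] the chain condition says that both ends have the same image, so the arc
    collapses. Otherwise the distance of the ends decides non-contraction on the whole arc, [F]
    being affine on a quadrant. *)
Definition good_arc (C D : Z) (arcs : seq arc) (x : arc) : bool :=
  let: (p, q, l, js) := x in
  [&& same_quadrant p q,
    nilp js || (Zdist p q <=? Zdist (ZF C D p) (ZF C D q)),
    chain (ZF C D p) (ZF C D q) [seq (nth arc0 arcs j).1.1 | j <- js],
    all (fun j => j < size arcs)%N js,
    all (fun j => (nth arc0 arcs j).1.2 <= l)%N js &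
    (count (fun j => (nth arc0 arcs j).1.2 == l) js <= 1)%N].

Definition good_subdivision (C D : Z) (segments : seq (Zpoint * Zpoint))
    (groups : seq (seq arc)) : bool :=
  let arcs := flatten groups in
  [&& 0 <? D, all (good_arc C D arcs) arcs &
    all2 (fun s g => (0 < size g)%N && chain s.1 s.2 [seq x.1.1 | x <- g])
      segments groups].

(** The images of the ends determine the iterate on the whole segment as long as every intermediate
    segment stays in one closed quadrant; [None] signals that this fails. *)
Fixpoint iter_segment (C D : Z) (n : nat) (p q : Zpoint) : option (Zpoint * Zpoint) :=
  if n is n'.+1 then
    if same_quadrant p q then iter_segment C D n' (ZF C D p) (ZF C D q) else None
  else Some (p, q).

Definition maps_onto (C D : Z) (n : nat) (s t : Zpoint * Zpoint) : bool :=
  if iter_segment C D n s.1 s.2 is Some (p, q) then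
    Zpoint_eqb p t.1 && Zpoint_eqb q t.2 || Zpoint_eqb p t.2 && Zpoint_eqb q t.1
  else false.

Definition subsegment (s t : Zpoint * Zpoint) : bool :=
  on_segment t.1 t.2 s.1 && on_segment t.1 t.2 s.2.

Definition left_of (s t : Zpoint * Zpoint) : bool :=
  Z.max s.1.1 s.2.1 <? Z.min t.1.1 t.2.1.

Definition horseshoe (C D : Z) (n : nat) (segments : seq (Zpoint * Zpoint))
    (j j0 j1 : Zpoint * Zpoint) : bool :=
  [&& (0 < n)%N, 0 <? D, has (subsegment j) segments, subsegment j0 j, subsegment j1 j,
    maps_onto C D n j0 j, maps_onto C D n j1 j & left_of j0 j1].

End ScaledPlane.

(** * Segments in the plane and the affine pieces of [F] *)

Section Segments.
Context {R : realType}.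
Implicit Types p q r x : R * R.

Lemma segmentP p q x : segment p q x <->
  exists t, [/\ 0 <= t <= 1, x.1 = (1 - t) * p.1 + t * q.1 &
                            x.2 = (1 - t) * p.2 + t * q.2].
Proof.
split=> [[t + <-]|[t [t01 x1 x2]]]; rewrite /= ?in_itv /=; first by exists t.
by exists t; rewrite /= ?in_itv//= [RHS]surjective_pairing x1 x2.
Qed.

Lemma segmentC p q x : segment p q x -> segment q p x.
Proof.
move=> /segmentP[t [/andP[t0 t1] x1 x2]]; apply/segmentP; exists (1 - t).
by split; [lra|rewrite x1; ring|rewrite x2; ring].
Qed.

Lemma segment_end p q : segment p q q.
Proof. by apply/segmentP; exists 1; split; [lra|ring|ring]. Qed.

Lemma segment_convex p q a b x :
  segment p q a -> segment p q b -> segment a b x -> segment p q x.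
Proof.
move=> /segmentP[t [/andP[t0 t1] a1 a2]] /segmentP[s [/andP[s0 s1] b1 b2]].
move=> /segmentP[u [/andP[u0 u1] x1 x2]]; apply/segmentP.
exists ((1 - u) * t + u * s); split; first by apply/andP; split; nra.
  by rewrite x1 a1 b1; ring.
by rewrite x2 a2 b2; ring.
Qed.

(** The parameters of [x] and [r] along the segment are compared; the second half reduces to the
    first by exchanging the ends. *)
Lemma segment_split p q r x :
  segment p q r -> segment p q x -> segment p r x \/ segment r q x.
Proof.
have half p' q' r' x' t s : 0 <= t -> t <= s ->
    r'.1 = (1 - s) * p'.1 + s * q'.1 -> r'.2 = (1 - s) * p'.2 + s * q'.2 ->
    x'.1 = (1 - t) * p'.1 + t * q'.1 -> x'.2 = (1 - t) * p'.2 + t * q'.2 ->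
    segment p' r' x'.
  (* The new parameter is [t / s]; for [s = 0] the half degenerates to a point and [t = 0]. *)
  move=> t0 ts r1 r2 x1 x2; apply/segmentP; have [s0|s0] := eqVneq s 0.
    have t00 : t = 0 by lra.
    by exists 0; split; [lra|rewrite x1 t00; ring|rewrite x2 t00; ring].
  have sp : 0 < s by rewrite lt_neqAle eq_sym s0 (le_trans t0).
  exists (t / s); split.
  - by rewrite divr_ge0 ?(ltW sp)//= ler_pdivrMr// mul1r.
  - by rewrite x1 r1; field.
  - by rewrite x2 r2; field.
move=> /segmentP[s [/andP[s0 s1] r1 r2]] /segmentP[t [/andP[t0 t1] x1 x2]].
have [ts|/ltW st] := leP t s; first by left; apply: (half _ q _ _ t s).
right; apply: segmentC; apply: (half q p r x (1 - t) (1 - s)); lra.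
Qed.

Lemma normr_affine (u v t : R) : 0 <= t <= 1 ->
  (0 <= u /\ 0 <= v) \/ (u <= 0 /\ v <= 0) ->
  `|(1 - t) * u + t * v| = (1 - t) * `|u| + t * `|v|.
Proof.
move=> /andP[t0 t1] [[u0 v0]|[u0 v0]].
  by rewrite !ger0_norm//; nra.
by rewrite !ler0_norm//; [ring|nra].
Qed.

Definition quadrant_mates p q : Prop :=
  ((0 <= p.1 /\ 0 <= q.1) \/ (p.1 <= 0 /\ q.1 <= 0)) /\
  ((0 <= p.2 /\ 0 <= q.2) \/ (p.2 <= 0 /\ q.2 <= 0)).

Lemma F_affine a b p q t : quadrant_mates p q -> 0 <= t <= 1 ->
  F a b ((1 - t) *: p + t *: q) = (1 - t) *: F a b p + t *: F a b q.
Proof.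
move=> [s1 s2] t01; congr pair => /=.
  by rewrite normr_affine// /GRing.scale /=; ring.
by rewrite normr_affine// /GRing.scale /=; ring.
Qed.

Definition sup_dist p q : R := Num.max `|p.1 - q.1| `|p.2 - q.2|.

(** The balls of the product are those of the sup distance. Along a segment, comparing distances
    before and after an affine map thus reduces to comparing two lengths. *)
Lemma ball_segment p q (s t r : R) :
  ball ((1 - s) *: p + s *: q) r ((1 - t) *: p + t *: q) <->
  `|s - t| * sup_dist p q < r.
Proof.
have coord (u v : R) :
    ball ((1 - s) * u + s * v) r ((1 - t) * u + t * v) <-> `|s - t| * `|u - v| < r.
  have duv : (1 - s) * u + s * v - ((1 - t) * u + t * v) = (t - s) * (u - v) by ring.
  by rewrite -ball_normE /ball_ /= duv normrM (distrC t s); split.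
rewrite /sup_dist maxr_pMr// gt_max; split.
  by move=> [/coord-> /coord->].
by move=> /andP[/coord h1 /coord h2].
Qed.

(** Pigeonhole: with [d] the length of the segment in units of [e], the segment falls into
    [Num.truncn d + 1] cells, and two points of one cell are closer than [e]. *)
Lemma separated_segment_bound (f : R * R -> R * R) p q (e : R) : 0 < e ->
  exists C, forall s : seq (R * R), uniq s -> (forall x, x \in s -> segment p q x) ->
    Defs.separated f 1 e [set` s] -> (size s <= C)%N.
Proof.
move=> e0; pose d := sup_dist p q / e.
have d0 : 0 <= d by rewrite divr_ge0 ?(ltW e0)// le_max normr_ge0.
exists (Num.truncn d).+1 => s us ss sep.
have /choice[t tP] x : exists t, segment p q x ->
    [/\ 0 <= t, t <= 1 & x = (1 - t) *: p + t *: q].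
  have [[t + <-]|nx] := pselect (segment p q x); last by exists 0.
  by rewrite /= in_itv /= => /andP[t0 t1]; exists t.
pose phi x := Num.truncn (t x * d).
rewrite -(size_map phi) -[leqRHS](size_iota 0) uniq_leq_size//; last first.
  move=> _ /mapP[x xs ->]; rewrite mem_iota /= add0n ltnS.
  have [t0 t1 _] := tP _ (ss _ xs).
  by apply: le_truncn; rewrite ler_piMl.
rewrite map_inj_in_uniq// => x y xs ys pxy.
apply/eqP; apply: contraT => xy; have [[|//] _ nb] := sep x y xs ys xy.
exfalso; apply: nb => /=.
have [tx0 tx1 ->] := tP _ (ss _ xs); have [ty0 ty1 ->] := tP _ (ss _ ys).
apply/ball_segment.
have := truncn_itv (mulr_ge0 tx0 d0); have := truncn_itv (mulr_ge0 ty0 d0).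
rewrite -/(phi x) -/(phi y) pxy => /andP[y1 y2] /andP[x1 x2].
have : `|t x * d - t y * d| < 1.
  rewrite ltr_norml; move: x1 x2 y1 y2; rewrite -!natr1; lra.
rewrite -mulrBl normrM (ger0_norm d0) /d mulrA.
by rewrite ltr_pdivrMr// mul1r.
Qed.

End Segments.

(** * From integral points to the plane *)

Section Embedding.
Context {R : realType}.
Variables (C D : Z).
Hypothesis D_gt0 : Z.ltb 0 D.

Definition ZtoR (x : Z) : R := (int_of_Z x)%:~R.

Lemma ZtoRN x : ZtoR (Z.opp x) = - ZtoR x.
Proof. by rewrite /ZtoR -rmorphN; congr _%:~R; lia. Qed.

Lemma ZtoRD x y : ZtoR (Z.add x y) = ZtoR x + ZtoR y.
Proof. by rewrite /ZtoR -rmorphD; congr _%:~R; lia. Qed.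

Lemma ZtoRB x y : ZtoR (Z.sub x y) = ZtoR x - ZtoR y.
Proof. by rewrite /ZtoR -rmorphB; congr _%:~R; lia. Qed.

Lemma ZtoRM x y : ZtoR (Z.mul x y) = ZtoR x * ZtoR y.
Proof. by rewrite /ZtoR -rmorphM; congr _%:~R; lia. Qed.

Lemma ZtoR_le x y : Z.leb x y -> ZtoR x <= ZtoR y.
Proof. by move=> xy; rewrite ler_int; lia. Qed.

Lemma ZtoR_abs x : ZtoR (Z.abs x) = `|ZtoR x|.
Proof. by rewrite -intr_norm; congr _%:~R; lia. Qed.

Lemma ZtoR_max x y : ZtoR (Z.max x y) = Num.max (ZtoR x) (ZtoR y).
Proof.
case: (leP (ZtoR x) (ZtoR y)) => [|/ltW]; rewrite /ZtoR ler_int => xy;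
  by congr _%:~R; lia.
Qed.

Lemma ZtoR_gt0 : 0 < ZtoR D.
Proof. by rewrite ltr0z; move: D_gt0; lia. Qed.

Definition emb (p : Zpoint) : R * R := (ZtoR p.1 / ZtoR D, ZtoR p.2 / ZtoR D).

Lemma le_emb x y : Z.leb x y -> ZtoR x / ZtoR D <= ZtoR y / ZtoR D.
Proof. by move=> xy; rewrite ler_pM2r ?invr_gt0 ?ZtoR_gt0// ZtoR_le. Qed.

(** Absolute values commute with division by the positive [D], so clearing the denominator turns [F]
    into [ZF]. *)
Lemma F_emb p : F (-1) (ZtoR C / ZtoR D) (emb p) = emb (ZF C D p).
Proof.
have D0 := ZtoR_gt0; have nD : `|(ZtoR D)^-1| = (ZtoR D)^-1.
  by rewrite ger0_norm// invr_ge0 ltW.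
have Dn0 : ZtoR D != 0 by rewrite gt_eqF.
by rewrite /F /emb /ZF /= !(ZtoRB, ZtoRD) ?ZtoRN !ZtoR_abs !normrM nD; congr pair; field.
Qed.

Lemma same_sign_emb x y : same_sign x y ->
  (0 <= ZtoR x / ZtoR D /\ 0 <= ZtoR y / ZtoR D) \/
  (ZtoR x / ZtoR D <= 0 /\ ZtoR y / ZtoR D <= 0).
Proof.
have D0 : ZtoR 0 / ZtoR D = 0 by rewrite mul0r.
by move=> /orP[] /andP[/le_emb + /le_emb]; rewrite D0; [left|right].
Qed.

Lemma same_quadrant_emb p q : same_quadrant p q -> quadrant_mates (emb p) (emb q).
Proof. by move=> /andP[/same_sign_emb s1 /same_sign_emb s2]. Qed.

Lemma Zpoint_eqbP p q : Zpoint_eqb p q -> p = q.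
Proof.
by case: p q => [a b] [a' b'] /andP[/Z.eqb_spec/= -> /Z.eqb_spec/= ->].
Qed.

Lemma between_emb a b x : between a b x ->
  exists2 t : R, 0 <= t <= 1 & ZtoR x = (1 - t) * ZtoR a + t * ZtoR b.
Proof.
have incr u v y : Z.leb u y -> Z.leb y v ->
    exists2 t : R, 0 <= t <= 1 & ZtoR y = (1 - t) * ZtoR u + t * ZtoR v.
  move=> /ZtoR_le uy /ZtoR_le yv; have [uv|uv] := eqVneq (ZtoR u) (ZtoR v).
    by exists 0; [lra|lra].
  have uv0 : 0 < ZtoR v - ZtoR u.
    by rewrite subr_gt0 lt_neqAle uv (le_trans uy).
  exists ((ZtoR y - ZtoR u) / (ZtoR v - ZtoR u)); last by field; rewrite gt_eqF.
  by rewrite ler_pdivlMr// ler_pdivrMr//; lra.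
move=> /orP[] /andP[h1 h2]; first exact: incr.
by have [t t01 ->] := incr _ _ _ h1 h2; exists (1 - t); [lra|ring].
Qed.

(** Each coordinate of [r] supplies a parameter. If one coordinate is constant, the parameter of the
    other serves for both; on a diagonal the equation of the line carries the parameter of the
    abscissa over to the ordinate. *)
Lemma on_segment_emb p q r : on_segment p q r -> segment (emb p) (emb q) (emb r).
Proof.
have Dn0 : ZtoR D != 0 by rewrite gt_eqF// ZtoR_gt0.
have conv a b x t : ZtoR x = (1 - t) * ZtoR a + t * ZtoR b ->
    ZtoR x / ZtoR D = (1 - t) * (ZtoR a / ZtoR D) + t * (ZtoR b / ZtoR D).
  by move=> ->; field.
case: p q r => [a b] [a' b'] [x y] /and3P[/= ha hb].
have [t t01 xt] := between_emb ha; have [s s01 ys] := between_emb hb.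
case/or4P => /=.
- move=> /Z.eqb_spec aa; apply/segmentP; exists s.
  by split => //=; apply: conv => //; move: xt; rewrite aa => ->; ring.
- move=> /Z.eqb_spec bb; apply/segmentP; exists t.
  by split => //=; apply: conv => //; move: ys; rewrite bb => ->; ring.
- move=> /andP[/Z.eqb_spec/(congr1 ZtoR) ab /Z.eqb_spec/(congr1 ZtoR) ax].
  move: ab ax; rewrite !ZtoRB => ab ax.
  apply/segmentP; exists t; split => //=; apply: conv => //.
  have -> : ZtoR y = ZtoR x - (ZtoR a - ZtoR b) by lra.
  have -> : ZtoR b' = ZtoR a' - (ZtoR a - ZtoR b) by lra.
  by rewrite xt; ring.
- move=> /andP[/Z.eqb_spec/(congr1 ZtoR) ab /Z.eqb_spec/(congr1 ZtoR) ax].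
  move: ab ax; rewrite !ZtoRD => ab ax.
  apply/segmentP; exists t; split => //=; apply: conv => //.
  have -> : ZtoR y = (ZtoR a + ZtoR b) - ZtoR x by lra.
  have -> : ZtoR b' = (ZtoR a + ZtoR b) - ZtoR a' by lra.
  by rewrite xt; ring.
Qed.

Definition seg (s : Zpoint * Zpoint) : set (R * R) := segment (emb s.1) (emb s.2).

Definition segs_union (ss : seq (Zpoint * Zpoint)) : set (R * R) :=
  [set x | has (fun s => `[< seg s x >]) ss].

(** A point of the segment lies before or after the far end [r] of the first link, and induction
    handles the rest. The first alternative is the empty chain, where [p = q]. *)
Lemma chain_emb p q ss x : chain p q ss -> seg (p, q) x ->
  (ss = [::] /\ x = emb q) \/ segs_union ss x.
Proof.
elim: ss p => [|[a b] ss IH] p /=.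
  move=> /Zpoint_eqbP <- /segmentP[t [_ /= x1 x2]]; left; split=> //.
  rewrite [LHS]surjective_pairing x1 x2 /emb.
  by congr pair; ring.
move=> /and3P[pab /on_segment_emb pqr ch] pqx; right; apply/orP.
set r := if _ then b else a in pqr ch.
have abr : forall y, segment (emb p) (emb r) y -> seg (a, b) y.
  rewrite /r; move: pab; case: ifP => [/Zpoint_eqbP-> //|_ /=].
  by move=> /Zpoint_eqbP-> y; exact: segmentC.
have [h|h] := segment_split pqr pqx; first by left; apply/asboolP/abr.
(* If no link is left then [r = q], and the point is the end of the link just removed. *)
have [[ss0 ->]|] := IH _ ch h; last by right.
left; apply/asboolP/abr; move: ch; rewrite ss0 /= => /Zpoint_eqbP <-; exact: segment_end.
Qed.

Let f := F (-1) (ZtoR C / ZtoR D).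

Lemma f_segment p q t : same_quadrant p q -> 0 <= t <= 1 ->
  f ((1 - t) *: emb p + t *: emb q) =
  (1 - t) *: emb (ZF C D p) + t *: emb (ZF C D q).
Proof.
by move=> /same_quadrant_emb pq t01; rewrite /f F_affine// !F_emb.
Qed.

Lemma sup_dist_emb p q : sup_dist (emb p) (emb q) = ZtoR (Zdist p q) / ZtoR D.
Proof.
have D0 := ZtoR_gt0.
rewrite /Zdist ZtoR_max !ZtoR_abs !ZtoRB maxr_pMl; last by rewrite invr_ge0 ltW.
by rewrite /sup_dist /emb /= -!mulrBl !normrM (ger0_norm (x := (ZtoR D)^-1))// invr_ge0 ltW.
Qed.

(** The arcs are the sets [A] of [topological_entropy_le0]; the checks of [good_arc], made at the
    ends, extend to whole arcs because [F] is affine there. *)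
Lemma good_subdivision_entropy_le0 (K : set (R * R)) (segments : seq (Zpoint * Zpoint))
    (groups : seq (seq arc)) :
  good_subdivision C D segments groups -> K `<=` segs_union segments ->
  (topological_entropy f K <= 0)%E.
Proof.
case/and3P => _ /all_nthP-/(_ arc0) good cover Ksegs.
set arcs := flatten groups in good.
pose A i : set (R * R) := seg (nth arc0 arcs i).1.1.
apply: (@topological_entropy_le0 _ _ f K (size arcs) A
  (fun i => (nth arc0 arcs i).2) (fun i => (nth arc0 arcs i).1.2)).
- move=> i j /good; case: (nth _ _ _) => [[[p q] l] js] /=.
  by move=> /and5P[_ _ _ /allP h _] /h.
- move=> i x /good; rewrite /A; case: (nth _ _ _) => [[[p q] l] js] /=.
  move=> /and5P[pq _ ch _ _] + js0.
  move=> [t]; rewrite /= in_itv /= => t01 <-.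
  rewrite f_segment//.
  case: (chain_emb ch (x := (1 - t) *: emb (ZF C D p) + t *: emb (ZF C D q))).
  + by exists t; rewrite //= in_itv.
  + by case; case: js js0 {ch}.
  + by rewrite /segs_union /= has_map => /hasP[j jjs /asboolP jx]; exists j.
- move=> i x y /good; rewrite /A; case: (nth _ _ _) => [[[p q] l] js] /=.
  move=> /and5P[pq _ ch _ _] [t] + <- [s] + <- js0.
  rewrite /= !in_itv /= => t01 s01; rewrite !f_segment//.
  move: ch; rewrite js0 /= => /Zpoint_eqbP ->.
  (* The weights add up to 1, so both sides are the common image of the ends. *)
  by rewrite -!scalerDl !subrK.
- move=> i x y r /good; rewrite /A; case: (nth _ _ _) => [[[p q] l] js] /=.
  move=> /and5P[pq le _ _ _] [t] + <- [s] + <- js0.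
  rewrite /= !in_itv /= => t01 s01; rewrite !f_segment// => b.
  move/ball_segment: b => b; apply/ball_segment.
  apply: le_lt_trans b; rewrite !sup_dist_emb ler_wpM2l// le_emb//.
  by case/orP: le => //; case: js js0.
- move=> i j /good; case: (nth _ _ _) => [[[p q] l] js] /=.
  by move=> /and5P[_ _ _ _ /andP[/allP h _]] /h.
- move=> i /good; case: (nth _ _ _) => [[[p q] l] js] /=.
  by move=> /and5P[_ _ _ _ /andP[_ h]].
- by move=> i e _ e0; exact: separated_segment_bound.
move=> x /Ksegs Kx.
suff /hasP[a /(nthP arc0)[i im <-] /asboolP] : has (fun a : arc => `[< seg a.1.1 x >]) arcs.
  by exists i.
rewrite /arcs; move: Kx cover; rewrite /segs_union /=.
elim: segments groups {arcs good A Ksegs} => [|[p q] ss IH] [|g gs] //=.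
move=> + /andP[/andP[g0 ch] ssgs]; rewrite has_cat => /orP[/asboolP px|ssx].
  apply/orP; left; case: (chain_emb ch px) => [[]|].
    by case: g g0 {ch}.
  by rewrite /segs_union /= has_map.
by apply/orP; right; exact: IH.
Qed.

Lemma iter_segment_emb n p q p' q' t : iter_segment C D n p q = Some (p', q') ->
  0 <= t <= 1 ->
  iter n f ((1 - t) *: emb p + t *: emb q) = (1 - t) *: emb p' + t *: emb q'.
Proof.
elim: n p q => [|n IH] p q /=; first by move=> [-> ->].
case: ifP => // pq h t01; rewrite -iterS iterSr f_segment//; exact: IH.
Qed.

Lemma maps_onto_emb n s t : maps_onto C D n s t -> seg t `<=` iter n f @` seg s.
Proof.
rewrite /maps_onto; case E : iter_segment => [[p q]|//] h.
have sub : seg (p, q) `<=` iter n f @` seg s.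
  move=> x [u + <-]; rewrite /= in_itv /= => u01.
  exists ((1 - u) *: emb s.1 + u *: emb s.2); last exact: iter_segment_emb.
  by exists u; rewrite //= in_itv.
move=> x tx; apply: sub; move/orP: h => [] /andP[/Zpoint_eqbP -> /Zpoint_eqbP ->] //.
exact: segmentC.
Qed.

Lemma subsegment_emb s t : subsegment s t -> seg s `<=` seg t.
Proof. by move=> /andP[/on_segment_emb s1 /on_segment_emb s2] x; exact: segment_convex. Qed.

(** The scaled abscissae of the ends are integers, so a strict inequality leaves a gap of at least
    1, which is [1 / D] in the plane. This is the separation [e0] of the horseshoe. *)
Lemma left_of_ball s t x y : left_of s t -> seg s x -> seg t y ->
  ~ ball x (ZtoR D)^-1 y.
Proof.
move=> st /segmentP[u [u01 x1 _]] /segmentP[v [v01 y1 _]] [+ _].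
have D0 := ZtoR_gt0.
pose a := Z.max s.1.1 s.2.1.
have left z : Z.leb z a -> ZtoR z / ZtoR D <= ZtoR a / ZtoR D by exact: le_emb.
have right z : Z.leb (Z.add a 1) z -> ZtoR a / ZtoR D + (ZtoR D)^-1 <= ZtoR z / ZtoR D.
  move=> /le_emb; rewrite ZtoRD mulrDl (_ : ZtoR 1 = 1)// mul1r; exact.
have h1 := right t.2.1 ltac:(move: st; rewrite /left_of /a; lia).
have h2 := right t.1.1 ltac:(move: st; rewrite /left_of /a; lia).
have h3 := left s.2.1 ltac:(rewrite /a; lia).
have h4 := left s.1.1 ltac:(rewrite /a; lia).
rewrite -ball_normE /ball_ /= x1 y1 /= ltr_norml => /andP[+ _].
set A := ZtoR a / ZtoR D in h1 h2 h3 h4.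
move: u01 v01 => /andP[u0 u1] /andP[v0 v1].
have : (1 - u) * (ZtoR s.1.1 / ZtoR D) + u * (ZtoR s.2.1 / ZtoR D) <= A by nra.
have : A + (ZtoR D)^-1 <= (1 - v) * (ZtoR t.1.1 / ZtoR D) + v * (ZtoR t.2.1 / ZtoR D) by nra.
by rewrite /=; lra.
Qed.

Lemma horseshoe_segments_entropy_gt0 (K : set (R * R)) n segments
    (j j0 j1 : Zpoint * Zpoint) :
  horseshoe C D n segments j j0 j1 -> segs_union segments `<=` K ->
  (0 < topological_entropy f K)%E.
Proof.
case/and4P => n0 _ jss /and5P[/subsegment_emb s0 /subsegment_emb s1].
move=> /maps_onto_emb o0 /maps_onto_emb o1 lt ssK.
apply: (@horseshoe_entropy_gt0 _ _ f K (seg j) (seg j0) (seg j1) n (ZtoR D)^-1) => //.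
- by rewrite invr_gt0 ZtoR_gt0.
- by exists (emb j.2); exact: segment_end.
- move=> x jx; apply: ssK; apply: sub_has jss => s /subsegment_emb js.
  exact/asboolP/js.
- by move=> x y; exact: left_of_ball.
Qed.

End Embedding.

(** * Subdivisions that certify zero entropy *)

Section Certificates.
Local Open Scope Z_scope.

Definition ZGamma_neg (C D : Z) : seq (Zpoint * Zpoint) :=
  let P2 := (- C - 2 * D, - D) in
  let P3 := (C + 2 * D, - 3 * D) in
  let P4 := (C + 4 * D, 2 * C - D) in
  let P5 := (- C + 4 * D, 4 * C + 3 * D) in
  let P6 := (- 5 * C, 4 * C + 7 * D) in
  let R2 := (C, - D) in
  let R3 := (- C, 2 * C - D) in
  let R4 := (- 3 * C, 2 * C - D) in
  let R5 := (- 5 * C, - D) in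
  let R6 := (- 5 * C, - 4 * C - D) in
  let T2 := (- 5 * C - D, - 4 * C) in
  [:: (P2, T2); (P2, R2); (R2, P3); (R3, P4); (R4, P5); (R5, P6); (R6, T2)].

Definition ZGamma_pos (C D : Z) : seq (Zpoint * Zpoint) :=
  let P1 := (- C - 2 * D, - D) in
  let P2 := (C + 2 * D, - 3 * D) in
  let P3 := (C + 4 * D, 2 * C - D) in
  let P4 := (- C + 4 * D, 5 * D) in
  let R2 := (- 2 * C, - C + D) in
  let R3 := (3 * C - 2 * D, - D) in
  let R4 := (3 * C - 2 * D, 4 * C - 3 * D) in
  let R5 := (- C, 8 * C - 5 * D) in
  let R6 := (- 7 * C + 4 * D, - 8 * C + 5 * D) in
  let T2 := (C - D, 0) in
  let X2 := (0, C - D) in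
  let X3 := (- C, 2 * C - D) in
  let X4 := (- C, - 2 * C + D) in
  let X5 := (3 * C - 2 * D, - 2 * C + D) in
  let X6 := (5 * C - 4 * D, 2 * C - D) in
  let X7 := (- 7 * C + 4 * D, 4 * C - 3 * D) in
  let Y2 := (7 * C - 5 * D, - 6 * C + 4 * D) in
  let Z2 := (- 7 * C + 4 * D, 8 * C - 5 * D) in
  let Z3 := (- C, - 14 * C + 9 * D) in
  [:: (P4, R2); (P1, R3); (P2, X3); (X2, R4); (P3, X3); (R5, X4); (R2, X4); (R6, T2); (R3,
      X5); (R4, X6); (R5, Z2); (Z2, X7); (R6, Z3); (Z3, Y2)].

Fixpoint orbit (C D : Z) (n : nat) (p : Zpoint) : seq Zpoint :=
  if n is n'.+1 then p :: orbit C D n' (ZF C D p) else [::].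

Definition orbits (C D : Z) (ps : seq (Zpoint * nat)) : seq Zpoint :=
  flatten [seq orbit C D x.2 x.1 | x <- ps].

(* [(i, k, l, js)] is the arc of level [l] and image [js] from the [i]-th to the [k]-th
   vertex; each group subdivides one segment of the invariant graph. *)
Definition decode (vs : seq Zpoint) (gs : seq (seq (nat * nat * nat * seq nat))) :
    seq (seq arc) :=
  [seq [seq (nth (0, 0) vs x.1.1.1, nth (0, 0) vs x.1.1.2, x.1.2, x.2) | x <- g] | g <- gs].

(* [C_alpha / D_alpha] exceeds the left end of the interval for alpha by less than 2 ^ -88
   times the length of that interval, and [C_beta / D_beta] likewise with 2 ^ -96. *)
Definition C_alpha : Z := -3908432673518538719176905440248807.
Definition D_alpha : Z := 4783873600586199009854681011646078.

(** The starting points are those where the graph crosses the coordinate axes, and their orbits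
    contain its vertices. The long orbit reaches [P2] at index 7 and returns to it after
    [384 = 3 * 2 ^ 7] steps, whence [391 = 7 + 384]. *)
Definition vertices_alpha : seq Zpoint :=
  let C := C_alpha in let D := D_alpha in
  orbits C D [:: ((- C - D, 0), 391%N); ((0, C - D), 1%N); ((- 5 * C, 0), 2%N); ((0, C + D),
    1%N)].

Definition arcs_alpha : seq (seq (nat * nat * nat * seq nat)) :=
  [::
    [:: (7,12,7,[::175; 174; 173; 172; 171; 170; 169; 168; 167; 166; 165; 164; 163; 162; 161;
      160; 159; 158; 157; 156; 155; 154; 153; 152; 151; 150; 149; 148; 147; 146; 145; 144; 143;
      142; 141; 140; 139; 138; 137; 136; 135; 134; 133]); (12,204,1,[::132]);
      (204,300,2,[::131]); (300,108,1,[::130]); (108,156,3,[::129]); (156,348,1,[::128]);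
      (348,252,2,[::127]); (252,60,1,[::126]); (60,84,4,[::125]); (84,276,1,[::124]);
      (276,372,2,[::123]); (372,180,1,[::122]); (180,132,3,[::121]); (132,324,1,[::120]);
      (324,228,2,[::119]); (228,36,1,[::118]); (36,48,5,[::117]); (48,240,1,[::116]);
      (240,336,2,[::115]); (336,144,1,[::114]); (144,192,3,[::113]); (192,384,1,[::112]);
      (384,0,1,[::111;110]); (0,288,2,[::109]); (288,96,1,[::108]); (96,72,4,[::107]);
      (72,264,1,[::106]); (264,360,2,[::105]); (360,168,1,[::104]); (168,120,3,[::103]);
      (120,312,1,[::102]); (312,216,2,[::101]); (216,24,1,[::100]); (24,18,6,[::99]);
      (18,210,1,[::98]); (210,306,2,[::97]); (306,114,1,[::96]); (114,162,3,[::95]);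
      (162,354,1,[::94]); (354,258,2,[::93]); (258,66,1,[::92]); (66,90,4,[::91]);
      (90,282,1,[::90]); (282,378,2,[::89]); (378,186,1,[::88]); (186,138,3,[::87]);
      (138,330,1,[::86]); (330,234,2,[::85]); (234,42,1,[::84]); (42,30,5,[::83]);
      (30,222,1,[::82]); (222,318,2,[::81]); (318,126,1,[::80]); (126,174,3,[::79]);
      (174,366,1,[::78]); (366,270,2,[::77]); (270,78,1,[::76]); (78,54,4,[::75]);
      (54,246,1,[::74]); (246,342,2,[::73]); (342,150,1,[::72]); (150,102,3,[::71]);
      (102,294,1,[::70]); (294,198,2,[::69]); (198,394,1,[::68]); (394,390,0,[::]);
      (390,6,0,[::]); (6,393,0,[::])];
    [:: (7,199,1,[::175]); (199,295,2,[::174]); (295,103,1,[::173]); (103,151,3,[::172]);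
      (151,343,1,[::171]); (343,247,2,[::170]); (247,55,1,[::169]); (55,79,4,[::168]);
      (79,271,1,[::167]); (271,367,2,[::166]); (367,175,1,[::165]); (175,127,3,[::164]);
      (127,319,1,[::163]); (319,223,2,[::162]); (223,31,1,[::161]); (31,43,5,[::160]);
      (43,235,1,[::159]); (235,331,2,[::158]); (331,139,1,[::157]); (139,187,3,[::156]);
      (187,379,1,[::155]); (379,283,2,[::154]); (283,91,1,[::153]); (91,67,4,[::152]);
      (67,259,1,[::151]); (259,355,2,[::150]); (355,163,1,[::149]); (163,115,3,[::148]);
      (115,307,1,[::147]); (307,211,2,[::146]); (211,19,1,[::145]); (19,25,6,[::144]);
      (25,217,1,[::143]); (217,313,2,[::142]); (313,121,1,[::141]); (121,169,3,[::140]);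
      (169,361,1,[::139]); (361,265,2,[::138]); (265,73,1,[::137]); (73,97,4,[::136]);
      (97,289,1,[::135]); (289,1,2,[::134])];
    [:: (1,391,0,[::]); (391,385,0,[::176]); (385,193,1,[::177]); (193,145,3,[::178]);
      (145,337,1,[::179]); (337,241,2,[::180]); (241,49,1,[::181]); (49,37,5,[::182]);
      (37,229,1,[::183]); (229,325,2,[::184]); (325,133,1,[::185]); (133,181,3,[::186]);
      (181,373,1,[::187]); (373,277,2,[::188]); (277,85,1,[::189]); (85,61,4,[::190]);
      (61,253,1,[::191]); (253,349,2,[::192]); (349,157,1,[::193]); (157,109,3,[::194]);
      (109,301,1,[::195]); (301,205,2,[::196]); (205,13,1,[::197]); (13,2,7,[::198]);
      (2,290,2,[::199]); (290,98,1,[::200]); (98,74,4,[::201]); (74,266,1,[::202]);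
      (266,362,2,[::203]); (362,170,1,[::204]); (170,122,3,[::205]); (122,314,1,[::206]);
      (314,218,2,[::207]); (218,26,1,[::208]); (26,20,6,[::209]); (20,212,1,[::210]);
      (212,308,2,[::211]); (308,116,1,[::212]); (116,164,3,[::213]); (164,356,1,[::214]);
      (356,260,2,[::215]); (260,68,1,[::216]); (68,92,4,[::217]); (92,284,1,[::218]);
      (284,380,2,[::219]); (380,188,1,[::220]); (188,140,3,[::221]); (140,332,1,[::222]);
      (332,236,2,[::223]); (236,44,1,[::224]); (44,32,5,[::225]); (32,224,1,[::226]);
      (224,320,2,[::227]); (320,128,1,[::228]); (128,176,3,[::229]); (176,368,1,[::230]);
      (368,272,2,[::231]); (272,80,1,[::232]); (80,56,4,[::233]); (56,248,1,[::234]);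
      (248,344,2,[::235]); (344,152,1,[::236]); (152,104,3,[::237]); (104,296,1,[::238]);
      (296,200,2,[::239]); (200,8,1,[::240])];
    [:: (2,386,0,[::241]); (386,194,1,[::242]); (194,146,3,[::243]); (146,338,1,[::244]);
      (338,242,2,[::245]); (242,50,1,[::246]); (50,38,5,[::247]); (38,230,1,[::248]);
      (230,326,2,[::249]); (326,134,1,[::250]); (134,182,3,[::251]); (182,374,1,[::252]);
      (374,278,2,[::253]); (278,86,1,[::254]); (86,62,4,[::255]); (62,254,1,[::256]);
      (254,350,2,[::257]); (350,158,1,[::258]); (158,110,3,[::259]); (110,302,1,[::260]);
      (302,206,2,[::261]); (206,14,1,[::262]); (14,3,7,[::263]); (3,291,2,[::264]);
      (291,99,1,[::265]); (99,75,4,[::266]); (75,267,1,[::267]); (267,363,2,[::268]);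
      (363,171,1,[::269]); (171,123,3,[::270]); (123,315,1,[::271]); (315,219,2,[::272]);
      (219,27,1,[::273]); (27,21,6,[::274]); (21,213,1,[::275]); (213,309,2,[::276]);
      (309,117,1,[::277]); (117,165,3,[::278]); (165,357,1,[::279]); (357,261,2,[::280]);
      (261,69,1,[::281]); (69,93,4,[::282]); (93,285,1,[::283]); (285,381,2,[::284]);
      (381,189,1,[::285]); (189,141,3,[::286]); (141,333,1,[::287]); (333,237,2,[::288]);
      (237,45,1,[::289]); (45,33,5,[::290]); (33,225,1,[::291]); (225,321,2,[::292]);
      (321,129,1,[::293]); (129,177,3,[::294]); (177,369,1,[::295]); (369,273,2,[::296]);
      (273,81,1,[::297]); (81,57,4,[::298]); (57,249,1,[::299]); (249,345,2,[::300]);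
      (345,153,1,[::301]); (153,105,3,[::302]); (105,297,1,[::303]); (297,201,2,[::304]);
      (201,9,1,[::305])];
    [:: (3,387,0,[::306]); (387,195,1,[::307]); (195,147,3,[::308]); (147,339,1,[::309]);
      (339,243,2,[::310]); (243,51,1,[::311]); (51,39,5,[::312]); (39,231,1,[::313]);
      (231,327,2,[::314]); (327,135,1,[::315]); (135,183,3,[::316]); (183,375,1,[::317]);
      (375,279,2,[::318]); (279,87,1,[::319]); (87,63,4,[::320]); (63,255,1,[::321]);
      (255,351,2,[::322]); (351,159,1,[::323]); (159,111,3,[::324]); (111,303,1,[::325]);
      (303,207,2,[::326]); (207,15,1,[::327]); (15,4,7,[::328;329]); (4,292,2,[::330]);
      (292,100,1,[::331]); (100,76,4,[::332]); (76,268,1,[::333]); (268,364,2,[::334]);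
      (364,172,1,[::335]); (172,124,3,[::336]); (124,316,1,[::337]); (316,220,2,[::338]);
      (220,28,1,[::339]); (28,22,6,[::340]); (22,214,1,[::341]); (214,310,2,[::342]);
      (310,118,1,[::343]); (118,166,3,[::344]); (166,358,1,[::345]); (358,262,2,[::346]);
      (262,70,1,[::347]); (70,94,4,[::348]); (94,286,1,[::349]); (286,382,2,[::350]);
      (382,190,1,[::351]); (190,142,3,[::352]); (142,334,1,[::353]); (334,238,2,[::354]);
      (238,46,1,[::355]); (46,34,5,[::356]); (34,226,1,[::357]); (226,322,2,[::358]);
      (322,130,1,[::359]); (130,178,3,[::360]); (178,370,1,[::361]); (370,274,2,[::362]);
      (274,82,1,[::363]); (82,58,4,[::364]); (58,250,1,[::365]); (250,346,2,[::366]);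
      (346,154,1,[::367]); (154,106,3,[::368]); (106,298,1,[::369]); (298,202,2,[::370]);
      (202,10,1,[::371])];
    [:: (4,388,0,[::372]); (388,196,1,[::373]); (196,148,3,[::374]); (148,340,1,[::375]);
      (340,244,2,[::376]); (244,52,1,[::377]); (52,40,5,[::378]); (40,232,1,[::379]);
      (232,328,2,[::380]); (328,136,1,[::381]); (136,184,3,[::382]); (184,376,1,[::383]);
      (376,280,2,[::384]); (280,88,1,[::385]); (88,64,4,[::386]); (64,256,1,[::387]);
      (256,352,2,[::388]); (352,160,1,[::389]); (160,112,3,[::390]); (112,304,1,[::391]);
      (304,208,2,[::392]); (208,16,1,[::393]); (16,392,7,[::394]); (392,5,0,[::67]);
      (5,293,2,[::66; 65; 64; 63]); (293,101,1,[::62]); (101,77,4,[::61; 60; 59; 58; 57]);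
      (77,269,1,[::56]); (269,365,2,[::55]); (365,173,1,[::54]); (173,125,3,[::53]);
      (125,317,1,[::52]); (317,221,2,[::51]); (221,29,1,[::50]); (29,23,6,[::49; 48; 47; 46; 45;
      44; 43; 42; 41; 40; 39; 38; 37; 36; 35; 34; 33]); (23,215,1,[::32]); (215,311,2,[::31]);
      (311,119,1,[::30]); (119,167,3,[::29]); (167,359,1,[::28]); (359,263,2,[::27]);
      (263,71,1,[::26]); (71,95,4,[::25]); (95,287,1,[::24]); (287,383,2,[::23;22]);
      (383,191,1,[::21]); (191,143,3,[::20]); (143,335,1,[::19]); (335,239,2,[::18]);
      (239,47,1,[::17]); (47,35,5,[::16]); (35,227,1,[::15]); (227,323,2,[::14]);
      (323,131,1,[::13]); (131,179,3,[::12]); (179,371,1,[::11]); (371,275,2,[::10]);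
      (275,83,1,[::9]); (83,59,4,[::8]); (59,251,1,[::7]); (251,347,2,[::6]); (347,155,1,[::5]);
      (155,107,3,[::4]); (107,299,1,[::3]); (299,203,2,[::2]); (203,11,1,[::1])];
    [:: (5,389,0,[::66]); (389,197,1,[::65;64]); (197,149,3,[::63;62;61]); (149,341,1,[::60]);
      (341,245,2,[::59]); (245,53,1,[::58]); (53,41,5,[::57; 56; 55; 54; 53; 52; 51; 50; 49]);
      (41,233,1,[::48]); (233,329,2,[::47]); (329,137,1,[::46]); (137,185,3,[::45]);
      (185,377,1,[::44]); (377,281,2,[::43]); (281,89,1,[::42]); (89,65,4,[::41]);
      (65,257,1,[::40]); (257,353,2,[::39]); (353,161,1,[::38]); (161,113,3,[::37]);
      (113,305,1,[::36]); (305,209,2,[::35]); (209,17,1,[::34]); (17,393,7,[::33; 32; 31; 30;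
      29; 28; 27; 26; 25; 24; 23; 22; 21; 20; 19; 18; 17; 16; 15; 14; 13; 12; 11; 10; 9; 8; 7;
      6; 5; 4; 3; 2; 1; 0])]]%N.

Definition C_beta : Z := 1311637174306299640440563191117514712376.
Definition D_beta : Z := 1901109616951330625980237332139372865981.

(** The starting points again lie where the graph crosses the axes. The long orbit passes through
    [R6] at index 5; the image of [R6], at index 6, recurs after [448 = 7 * 2 ^ 6] steps, whence
    [454 = 6 + 448]. *)
Definition vertices_beta : seq Zpoint :=
  let C := C_beta in let D := D_beta in
  orbits C D [:: ((0, 2 * C - D), 454%N); ((0, 7 * C - 5 * D), 3%N); ((7 * C - 5 * D, 0),
    1%N); ((0, - D), 7%N); ((- C, 0), 2%N); ((- 7 * C + 4 * D, 0), 2%N); ((0, C + D), 5%N);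
    ((- 3 * C + D, 0), 1%N)].

Definition arcs_beta : seq (seq (nat * nat * nat * seq nat)) :=
  [::
    [:: (473,469,0,[::]); (469,8,8,[::44;45]); (8,232,1,[::46]); (232,344,2,[::47]);
      (344,120,1,[::48]); (120,176,3,[::49]); (176,400,1,[::50]); (400,288,2,[::51]);
      (288,64,1,[::52]); (64,92,4,[::53]); (92,316,1,[::54]); (316,428,2,[::55]);
      (428,204,1,[::56]); (204,148,3,[::57]); (148,372,1,[::58]); (372,260,2,[::59]);
      (260,36,1,[::60]); (36,50,5,[::61]); (50,274,1,[::62]); (274,386,2,[::63]);
      (386,162,1,[::64]); (162,218,3,[::65]); (218,442,1,[::66]); (442,330,2,[::67]);
      (330,106,1,[::68]); (106,78,4,[::69]); (78,302,1,[::70]); (302,414,2,[::71]);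
      (414,190,1,[::72]); (190,134,3,[::73]); (134,358,1,[::74]); (358,246,2,[::75]);
      (246,22,1,[::76]); (22,29,6,[::77]); (29,253,1,[::78]); (253,365,2,[::79]);
      (365,141,1,[::80]); (141,197,3,[::81]); (197,421,1,[::82]); (421,309,2,[::83]);
      (309,85,1,[::84]); (85,113,4,[::85]); (113,337,1,[::86]); (337,1,2,[::87])];
    [:: (470,458,8,[::88; 89; 90; 91; 92; 93; 94; 95; 96; 97; 98; 99; 100; 101; 102; 103; 104;
      105; 106; 107; 108; 109; 110; 111; 112; 113; 114; 115; 116; 117; 118; 119; 120; 121; 122;
      123; 124; 125; 126; 127; 128; 129; 130; 131; 132; 133; 134; 135; 136; 137; 138; 139; 140;
      141; 142; 143; 144; 145; 146; 147; 148; 149; 150; 151; 152; 153]); (458,9,7,[::157]);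
      (9,233,1,[::158]); (233,345,2,[::159]); (345,121,1,[::160]); (121,177,3,[::161]);
      (177,401,1,[::162]); (401,289,2,[::163]); (289,65,1,[::164]); (65,93,4,[::165]);
      (93,317,1,[::166]); (317,429,2,[::167]); (429,205,1,[::168]); (205,149,3,[::169]);
      (149,373,1,[::170]); (373,261,2,[::171]); (261,37,1,[::172]); (37,51,5,[::173]);
      (51,275,1,[::174]); (275,387,2,[::175]); (387,163,1,[::176]); (163,219,3,[::177]);
      (219,443,1,[::178]); (443,331,2,[::179]); (331,107,1,[::180]); (107,79,4,[::181]);
      (79,303,1,[::182]); (303,415,2,[::183]); (415,191,1,[::184]); (191,135,3,[::185]);
      (135,359,1,[::186]); (359,247,2,[::187]); (247,23,1,[::188]); (23,30,6,[::189]);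
      (30,254,1,[::190]); (254,366,2,[::191]); (366,142,1,[::192]); (142,198,3,[::193]);
      (198,422,1,[::194]); (422,310,2,[::195]); (310,86,1,[::196]); (86,114,4,[::197]);
      (114,338,1,[::198]); (338,2,2,[::199])];
    [:: (471,6,8,[::200]); (6,230,1,[::201]); (230,342,2,[::202]); (342,118,1,[::203]);
      (118,174,3,[::204]); (174,398,1,[::205]); (398,286,2,[::206]); (286,62,1,[::207]);
      (62,90,4,[::208]); (90,314,1,[::209]); (314,426,2,[::210]); (426,202,1,[::211]);
      (202,146,3,[::212]); (146,370,1,[::213]); (370,258,2,[::214]); (258,34,1,[::215]);
      (34,48,5,[::216]); (48,272,1,[::217]); (272,384,2,[::218]); (384,160,1,[::219]);
      (160,216,3,[::220]); (216,440,1,[::221]); (440,328,2,[::222]); (328,104,1,[::223]);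
      (104,76,4,[::224]); (76,300,1,[::225]); (300,412,2,[::226]); (412,188,1,[::227]);
      (188,132,3,[::228]); (132,356,1,[::229]); (356,244,2,[::230]); (244,20,1,[::231]);
      (20,27,6,[::232]); (27,251,1,[::233]); (251,363,2,[::234]); (363,139,1,[::235]);
      (139,195,3,[::236]); (195,419,1,[::237]); (419,307,2,[::238]); (307,83,1,[::239]);
      (83,111,4,[::240]); (111,335,1,[::241]); (335,447,2,[::242;243]); (447,223,1,[::244]);
      (223,167,3,[::245]); (167,391,1,[::246]); (391,279,2,[::247]); (279,55,1,[::248]);
      (55,41,5,[::249]); (41,265,1,[::250]); (265,377,2,[::251]); (377,153,1,[::252]);
      (153,209,3,[::253]); (209,433,1,[::254]); (433,321,2,[::255]); (321,97,1,[::256]);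
      (97,69,4,[::257]); (69,293,1,[::258]); (293,405,2,[::259]); (405,181,1,[::260]);
      (181,125,3,[::261]); (125,349,1,[::262]); (349,237,2,[::263]); (237,13,1,[::264]);
      (13,462,7,[::265]); (462,459,0,[::266]); (459,468,0,[::]); (468,466,0,[::]);
      (466,460,2,[::310;311])];
    [:: (459,10,7,[::309]); (10,234,1,[::308]); (234,346,2,[::307]); (346,122,1,[::306]);
      (122,178,3,[::305]); (178,402,1,[::304]); (402,290,2,[::303]); (290,66,1,[::302]);
      (66,94,4,[::301]); (94,318,1,[::300]); (318,430,2,[::299]); (430,206,1,[::298]);
      (206,150,3,[::297]); (150,374,1,[::296]); (374,262,2,[::295]); (262,38,1,[::294]);
      (38,52,5,[::293]); (52,276,1,[::292]); (276,388,2,[::291]); (388,164,1,[::290]);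
      (164,220,3,[::289]); (220,444,1,[::288]); (444,332,2,[::287]); (332,108,1,[::286]);
      (108,80,4,[::285]); (80,304,1,[::284]); (304,416,2,[::283]); (416,192,1,[::282]);
      (192,136,3,[::281]); (136,360,1,[::280]); (360,248,2,[::279]); (248,24,1,[::278]);
      (24,31,6,[::277]); (31,255,1,[::276]); (255,367,2,[::275]); (367,143,1,[::274]);
      (143,199,3,[::273]); (199,423,1,[::272]); (423,311,2,[::271]); (311,87,1,[::270]);
      (87,115,4,[::269]); (115,339,1,[::268]); (339,3,2,[::267])];
    [:: (472,7,8,[::0;1]); (7,231,1,[::2]); (231,343,2,[::3]); (343,119,1,[::4]);
      (119,175,3,[::5]); (175,399,1,[::6]); (399,287,2,[::7]); (287,63,1,[::8]);
      (63,91,4,[::9]); (91,315,1,[::10]); (315,427,2,[::11]); (427,203,1,[::12]);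
      (203,147,3,[::13]); (147,371,1,[::14]); (371,259,2,[::15]); (259,35,1,[::16]);
      (35,49,5,[::17]); (49,273,1,[::18]); (273,385,2,[::19]); (385,161,1,[::20]);
      (161,217,3,[::21]); (217,441,1,[::22]); (441,329,2,[::23]); (329,105,1,[::24]);
      (105,77,4,[::25]); (77,301,1,[::26]); (301,413,2,[::27]); (413,189,1,[::28]);
      (189,133,3,[::29]); (133,357,1,[::30]); (357,245,2,[::31]); (245,21,1,[::32]);
      (21,28,6,[::33]); (28,252,1,[::34]); (252,364,2,[::35]); (364,140,1,[::36]);
      (140,196,3,[::37]); (196,420,1,[::38]); (420,308,2,[::39]); (308,84,1,[::40]);
      (84,112,4,[::41]); (112,336,1,[::42]); (336,0,2,[::43]); (0,448,0,[::312]);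
      (448,224,1,[::313]); (224,168,3,[::314]); (168,392,1,[::315]); (392,280,2,[::316]);
      (280,56,1,[::317]); (56,42,5,[::318]); (42,266,1,[::319]); (266,378,2,[::320]);
      (378,154,1,[::321]); (154,210,3,[::322]); (210,434,1,[::323]); (434,322,2,[::324]);
      (322,98,1,[::325]); (98,70,4,[::326]); (70,294,1,[::327]); (294,406,2,[::328]);
      (406,182,1,[::329]); (182,126,3,[::330]); (126,350,1,[::331]); (350,238,2,[::332]);
      (238,14,1,[::333]); (14,463,7,[::334;335]); (463,460,0,[::336])];
    [:: (4,340,2,[::337]); (340,116,1,[::338]); (116,88,4,[::339]); (88,312,1,[::340]);
      (312,424,2,[::341]); (424,200,1,[::342]); (200,144,3,[::343]); (144,368,1,[::344]);
      (368,256,2,[::345]); (256,32,1,[::346]); (32,25,6,[::347]); (25,249,1,[::348]);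
      (249,361,2,[::349]); (361,137,1,[::350]); (137,193,3,[::351]); (193,417,1,[::352]);
      (417,305,2,[::353]); (305,81,1,[::354]); (81,109,4,[::355]); (109,333,1,[::356]);
      (333,445,2,[::357]); (445,221,1,[::358]); (221,165,3,[::359]); (165,389,1,[::360]);
      (389,277,2,[::361]); (277,53,1,[::362]); (53,39,5,[::363]); (39,263,1,[::364]);
      (263,375,2,[::365]); (375,151,1,[::366]); (151,207,3,[::367]); (207,431,1,[::368]);
      (431,319,2,[::369]); (319,95,1,[::370]); (95,67,4,[::371]); (67,291,1,[::372]);
      (291,403,2,[::373]); (403,179,1,[::374]); (179,123,3,[::375]); (123,347,1,[::376]);
      (347,235,2,[::377]); (235,11,1,[::378]); (11,460,7,[::379]); (460,465,2,[::380]);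
      (465,461,1,[::155;154;153])];
    [:: (1,449,0,[::381]); (449,225,1,[::382]); (225,169,3,[::383]); (169,393,1,[::384]);
      (393,281,2,[::385]); (281,57,1,[::386]); (57,43,5,[::387]); (43,267,1,[::388]);
      (267,379,2,[::389]); (379,155,1,[::390]); (155,211,3,[::391]); (211,435,1,[::392]);
      (435,323,2,[::393]); (323,99,1,[::394]); (99,71,4,[::395]); (71,295,1,[::396]);
      (295,407,2,[::397]); (407,183,1,[::398]); (183,127,3,[::399]); (127,351,1,[::400]);
      (351,239,2,[::401]); (239,15,1,[::402]); (15,474,7,[::403]); (474,464,0,[::]);
      (464,461,0,[::])];
    [:: (5,341,2,[::89;90]); (341,117,1,[::91]); (117,89,4,[::92; 93; 94; 95; 96]);
      (89,313,1,[::97]); (313,425,2,[::98]); (425,201,1,[::99]); (201,145,3,[::100]);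
      (145,369,1,[::101]); (369,257,2,[::102]); (257,33,1,[::103]); (33,26,6,[::104; 105; 106;
      107; 108; 109; 110; 111; 112; 113; 114; 115; 116; 117; 118; 119; 120]);
      (26,250,1,[::121]); (250,362,2,[::122]); (362,138,1,[::123]); (138,194,3,[::124]);
      (194,418,1,[::125]); (418,306,2,[::126]); (306,82,1,[::127]); (82,110,4,[::128]);
      (110,334,1,[::129]); (334,446,2,[::130]); (446,222,1,[::131]); (222,166,3,[::132]);
      (166,390,1,[::133]); (390,278,2,[::134]); (278,54,1,[::135]); (54,40,5,[::136]);
      (40,264,1,[::137]); (264,376,2,[::138]); (376,152,1,[::139]); (152,208,3,[::140]);
      (208,432,1,[::141]); (432,320,2,[::142]); (320,96,1,[::143]); (96,68,4,[::144]);
      (68,292,1,[::145]); (292,404,2,[::146]); (404,180,1,[::147]); (180,124,3,[::148]);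
      (124,348,1,[::149]); (348,236,2,[::150]); (236,12,1,[::151]); (12,461,7,[::152]);
      (461,466,2,[::153; 154; 155; 156])];
    [:: (2,450,0,[::404]); (450,226,1,[::405;406;407]); (226,170,3,[::408]);
      (170,394,1,[::409]); (394,282,2,[::410]); (282,58,1,[::411]); (58,44,5,[::412]);
      (44,268,1,[::413]); (268,380,2,[::414]); (380,156,1,[::415]); (156,212,3,[::416]);
      (212,436,1,[::417]); (436,324,2,[::418]); (324,100,1,[::419]); (100,72,4,[::420]);
      (72,296,1,[::421]); (296,408,2,[::422]); (408,184,1,[::423]); (184,128,3,[::424]);
      (128,352,1,[::425]); (352,240,2,[::426]); (240,16,1,[::427]); (16,462,7,[::428])];
    [:: (3,451,0,[::429]); (451,454,0,[::430]); (454,457,0,[::]); (457,227,1,[::431]);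
      (227,171,3,[::432]); (171,395,1,[::433]); (395,283,2,[::434]); (283,59,1,[::435]);
      (59,45,5,[::436]); (45,269,1,[::437]); (269,381,2,[::438]); (381,157,1,[::439]);
      (157,213,3,[::440]); (213,437,1,[::441]); (437,325,2,[::442]); (325,101,1,[::443]);
      (101,73,4,[::444]); (73,297,1,[::445]); (297,409,2,[::446]); (409,185,1,[::447]);
      (185,129,3,[::448]); (129,353,1,[::449]); (353,241,2,[::450]); (241,17,1,[::451]);
      (17,463,7,[::452;453])];
    [:: (4,452,0,[::454]); (452,455,0,[::455])];
    [:: (455,228,1,[::456]); (228,172,3,[::457]); (172,396,1,[::458]); (396,284,2,[::459]);
      (284,60,1,[::460]); (60,46,5,[::461]); (46,270,1,[::462]); (270,382,2,[::463]);
      (382,158,1,[::464]); (158,214,3,[::465]); (214,438,1,[::466]); (438,326,2,[::467]);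
      (326,102,1,[::468]); (102,74,4,[::469]); (74,298,1,[::470]); (298,410,2,[::471]);
      (410,186,1,[::472]); (186,130,3,[::473]); (130,354,1,[::474]); (354,242,2,[::475]);
      (242,18,1,[::476]); (18,467,7,[::477]); (467,464,1,[::154;153])];
    [:: (5,453,0,[::]); (453,456,0,[::])];
    [:: (456,229,1,[::89]); (229,173,3,[::90;91;92]); (173,397,1,[::93]); (397,285,2,[::94]);
      (285,61,1,[::95]); (61,47,5,[::96; 97; 98; 99; 100; 101; 102; 103; 104]);
      (47,271,1,[::105]); (271,383,2,[::106]); (383,159,1,[::107]); (159,215,3,[::108]);
      (215,439,1,[::109]); (439,327,2,[::110]); (327,103,1,[::111]); (103,75,4,[::112]);
      (75,299,1,[::113]); (299,411,2,[::114]); (411,187,1,[::115]); (187,131,3,[::116]);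
      (131,355,1,[::117]); (355,243,2,[::118]); (243,19,1,[::119]); (19,468,7,[::120; 121; 122;
      123; 124; 125; 126; 127; 128; 129; 130; 131; 132; 133; 134; 135; 136; 137; 138; 139; 140;
      141; 142; 143; 144; 145; 146; 147; 148; 149; 150; 151; 152; 153; 154; 155; 156])]]%N.

Lemma good_alpha :
  good_subdivision C_alpha D_alpha (ZGamma_neg C_alpha D_alpha)
    (decode vertices_alpha arcs_alpha).
Proof. by vm_compute. Qed.

Lemma good_beta :
  good_subdivision C_beta D_beta (ZGamma_pos C_beta D_beta)
    (decode vertices_beta arcs_beta).
Proof. by vm_compute. Qed.

End Certificates.

(** * Horseshoes at the right ends of the intervals *)

Section Horseshoes.
Local Open Scope Z_scope.

(* [C_alpha' / D_alpha'] and [C_beta' / D_beta'] are the right ends of the two intervals;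
   the common factors 2 ^ 25 and 2 ^ 30 make the endpoints of the horseshoes integral. *)
Definition C_alpha' : Z := - 1049417824596806956103568 * 2 ^ 25.
Definition D_alpha' : Z := 1284474531463219438945271 * 2 ^ 25.

(** [J] lies on the segment from [R6] to [T2]. Each step preserves or doubles lengths; over the 96
    steps [J0] is stretched by [2 ^ 53] and [J1] by [2 ^ 54]. *)
Definition J_alpha : Zpoint * Zpoint :=
  ((158456785657596688915668708360192, 115356972335882231750501460869120),
   (158456784214647169344247290658816, 115356973778831751321922878570496)).
Definition J0_alpha : Zpoint * Zpoint :=
  ((158456784214647169344247290658816, 115356973778831751321922878570496),
   (158456784214647169344247450858394, 115356973778831751321922718370918)).
Definition J1_alpha : Zpoint * Zpoint :=
  ((158456785657596678164857095600589, 115356972335882242501313073628723),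
   (158456785657596678164857015500800, 115356972335882242501313153728512)).

Lemma horseshoe_alpha :
  horseshoe C_alpha' D_alpha' 96 (ZGamma_neg C_alpha' D_alpha')
    J_alpha J0_alpha J1_alpha.
Proof. by vm_compute. Qed.

Definition C_beta' : Z := 945506314303393205598153 * 2 ^ 30.
Definition D_beta' : Z := 1370433212950874384162254 * 2 ^ 30.

Definition J_beta : Zpoint * Zpoint :=
  ((-1015229674523642709968167813251072, -969792323634527386747051488313344),
   (-1015229674359005519110310065078272, -969792323469890195889193740140544)).
Definition J0_beta : Zpoint * Zpoint :=
  ((-1015229674523642709929835230143197, -969792323634527386708718905205469),
   (-1015229674523642709929835230134272, -969792323634527386708718905196544)).
Definition J1_beta : Zpoint * Zpoint :=
  ((-1015229674359005519110310065078272, -969792323469890195889193740140544),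
   (-1015229674359005519110310065087197, -969792323469890195889193740149469)).

Lemma horseshoe_beta :
  horseshoe C_beta' D_beta' 112 (ZGamma_pos C_beta' D_beta')
    J_beta J0_beta J1_beta.
Proof. by vm_compute. Qed.

End Horseshoes.

(** * Identification of the graphs with their integral models *)

Section GammaSegments.
Context {R : realType}.
Variables (C D : Z).
Hypothesis D_gt0 : Z.ltb 0 D.

Lemma segs_union_nil : segs_union D [::] = set0 :> set (R * R).
Proof. by apply/predeqP. Qed.

Lemma segs_union_cons s ss :
  segs_union D (s :: ss) = seg D s `|` segs_union D ss :> set (R * R).
Proof.
apply/predeqP => x; split=> [/= /orP[/asboolP|]|[|] h]; [by left|by right| |].
  by apply/orP; left; apply/asboolP.
by apply/orP; right.
Qed.

Lemma segment_emb (x1 y1 x2 y2 : R) X1 Y1 X2 Y2 :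
  x1 * ZtoR D = ZtoR X1 -> y1 * ZtoR D = ZtoR Y1 ->
  x2 * ZtoR D = ZtoR X2 -> y2 * ZtoR D = ZtoR Y2 ->
  segment (x1, y1) (x2, y2) = seg D ((X1, Y1), (X2, Y2)).
Proof.
have Dn0 : ZtoR D != 0 :> R by rewrite gt_eqF// ZtoR_gt0.
by rewrite /seg /emb /= => <- <- <- <-; rewrite !mulfK.
Qed.

Let cD : ZtoR C / ZtoR D * ZtoR D = ZtoR C :> R.
Proof. by rewrite divfK// gt_eqF// ZtoR_gt0. Qed.

(** All vertex coordinates are affine in [c], so after multiplication by [D] they match by linear
    arithmetic from [c * D = C]. *)
Ltac identify_segments :=
  rewrite !segs_union_cons segs_union_nil setU0 !setUA; repeat congr (_ `|` _);
  apply: segment_emb; rewrite ?(ZtoRB, ZtoRD, ZtoRN, ZtoRM);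
  move: cD; set c := _ / _; rewrite /ZtoR; lra.

Lemma Gamma_neg_segs :
  Gamma_neg (ZtoR C / ZtoR D) = segs_union D (ZGamma_neg C D) :> set (R * R).
Proof. identify_segments. Qed.

Lemma Gamma_pos_segs :
  Gamma_pos (ZtoR C / ZtoR D) = segs_union D (ZGamma_pos C D) :> set (R * R).
Proof. identify_segments. Qed.

End GammaSegments.

(** * Sign of the entropy at certified parameters *)

Section GammaEntropy.
Context {R : realType}.
Variables (C D : Z).
Let c : R := ZtoR C / ZtoR D.

Lemma Gamma_neg_entropy_le0 groups : good_subdivision C D (ZGamma_neg C D) groups ->
  (topological_entropy (F (-1) c) (Gamma_neg c) <= 0)%E.
Proof.
move=> good; have /and3P[D0 _ _] := good.
by apply: (good_subdivision_entropy_le0 D0 good); rewrite -Gamma_neg_segs.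
Qed.

Lemma Gamma_pos_entropy_le0 groups : good_subdivision C D (ZGamma_pos C D) groups ->
  (topological_entropy (F (-1) c) (Gamma_pos c) <= 0)%E.
Proof.
move=> good; have /and3P[D0 _ _] := good.
by apply: (good_subdivision_entropy_le0 D0 good); rewrite -Gamma_pos_segs.
Qed.

Lemma Gamma_neg_entropy_gt0 n j j0 j1 : horseshoe C D n (ZGamma_neg C D) j j0 j1 ->
  (0 < topological_entropy (F (-1) c) (Gamma_neg c))%E.
Proof.
move=> hs; have /and3P[_ D0 _] := hs.
by apply: (horseshoe_segments_entropy_gt0 D0 hs); rewrite -Gamma_neg_segs.
Qed.

Lemma Gamma_pos_entropy_gt0 n j j0 j1 : horseshoe C D n (ZGamma_pos C D) j j0 j1 ->
  (0 < topological_entropy (F (-1) c) (Gamma_pos c))%E.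
Proof.
move=> hs; have /and3P[_ D0 _] := hs.
by apply: (horseshoe_segments_entropy_gt0 D0 hs); rewrite -Gamma_pos_segs.
Qed.

End GammaEntropy.

(** * Rational comparisons between the parameters and the interval ends *)

Section Numerics.
Context {R : realType}.

Let al : R := - (140850476140085945702816746162288%:R / 172399253286857828660669132569609%:R).
Let ar : R := - (1049417824596806956103568%:R / 1284474531463219438945271%:R).
Let a1 : R := - (3908432673518538719176905440248807%:R /
  4783873600586199009854681011646078%:R).

Lemma al_lt_a1 : al < a1.
Proof. by rewrite /al /a1; lra. Qed.

Lemma a1_itv : - (112 / 137) <= a1 <= - (13 / 16).
Proof. by rewrite /a1; lra. Qed.

Lemma ar_itv : - (112 / 137) <= ar <= - (13 / 16).
Proof. by rewrite /ar; lra. Qed.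

Lemma a_width : ar - al < 4 * 10 ^- 40.
Proof. by rewrite /ar /al; lra. Qed.

Lemma a1E : ZtoR C_alpha / ZtoR D_alpha = a1.
Proof. by rewrite /a1 /ZtoR /C_alpha /D_alpha; field. Qed.

Lemma arE : ZtoR C_alpha' / ZtoR D_alpha' = ar.
Proof. by rewrite /ar /C_alpha' /D_alpha' !ZtoRM /ZtoR; field. Qed.

Let bl : R := 798396920638883099973166531706985228123%:R /
  1157210312199077596904301690272087447914%:R.
Let br : R := 945506314303393205598153%:R / 1370433212950874384162254%:R.
Let b1 : R := 1311637174306299640440563191117514712376%:R /
  1901109616951330625980237332139372865981%:R.

Lemma bl_lt_b1 : bl < b1.
Proof. by rewrite /bl /b1; lra. Qed.

Lemma b1_itv : 603 / 874 <= b1 <= 563 / 816.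
Proof. by rewrite /b1; lra. Qed.

Lemma br_itv : 603 / 874 <= br <= 563 / 816.
Proof. by rewrite /br; lra. Qed.

Lemma b_width : br - bl < 5 * 10 ^- 50.
Proof. by rewrite /br /bl; lra. Qed.

Lemma b1E : ZtoR C_beta / ZtoR D_beta = b1.
Proof. by rewrite /b1 /ZtoR /C_beta /D_beta; field. Qed.

Lemma brE : ZtoR C_beta' / ZtoR D_beta' = br.
Proof. by rewrite /br /C_beta' /D_beta' !ZtoRM /ZtoR; field. Qed.

End Numerics.

Theorem proposition2 (R : realType) (alpha beta : R)
    (alpha_itv : - (112 / 137) < alpha < - (13 / 16))
    (alphaP : forall c : R, - (112 / 137) <= c <= - (13 / 16) ->
       ((0 < topological_entropy (F (-1) c) (Gamma_neg c))%E <-> alpha < c))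
    (beta_itv : 603 / 874 < beta < 563 / 816)
    (betaP : forall c : R, 603 / 874 <= c <= 563 / 816 ->
       ((0 < topological_entropy (F (-1) c) (Gamma_pos c))%E <-> beta < c)) :
  let al : R := - (140850476140085945702816746162288%:R
                   / 172399253286857828660669132569609%:R) in
  let ar : R := - (1049417824596806956103568%:R
                   / 1284474531463219438945271%:R) in
  let bl : R := 798396920638883099973166531706985228123%:R
                / 1157210312199077596904301690272087447914%:R in
  let br : R := 945506314303393205598153%:R
                / 1370433212950874384162254%:R in
  (al < alpha < ar /\ ar - al < 4 * 10 ^- 40) /\
  (bl < beta < br /\ br - bl < 5 * 10 ^- 50).
Proof.
move=> al ar bl br.
(* Zero entropy at a parameter only shows that it is at most [alpha]; testing [a1], slightly above
   [al], makes the bound at [al] strict. *)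
have lo_alpha : al < alpha.
  apply: lt_le_trans al_lt_a1 _; rewrite leNgt; apply/negP => /(alphaP _ a1_itv).
  by rewrite ltNge -a1E (Gamma_neg_entropy_le0 good_alpha).
(* Positive entropy is strict in the parameter, so the end [ar] itself can be tested. *)
have hi_alpha : alpha < ar.
  apply/(alphaP _ ar_itv).
  by rewrite -arE; exact: Gamma_neg_entropy_gt0 horseshoe_alpha.
have lo_beta : bl < beta.
  apply: lt_le_trans bl_lt_b1 _; rewrite leNgt; apply/negP => /(betaP _ b1_itv).
  by rewrite ltNge -b1E (Gamma_pos_entropy_le0 good_beta).
have hi_beta : beta < br.
  apply/(betaP _ br_itv).
  by rewrite -brE; exact: Gamma_pos_entropy_gt0 horseshoe_beta.
rewrite lo_alpha hi_alpha lo_beta hi_beta.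
by split; split; [|exact: a_width| |exact: b_width].
Qed.
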